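(* Let $M$ be a smooth manifold, $p\ge 1$ an integer, and $L\subset TM\oplus\wedge^pT^*M$ a Lagrangian subbundle. Assume that $S:=pr_{TM}(L)$ has constant rank along $M$. Let $\omega\in\Omega^{p+1}(M)$ be a $(p+1)$-form such that $$L=\{X+\iota_X\omega+\alpha : X\in S,\ \alpha\in\wedge^pS^\circ\}.$$ Then $L$ is involutive if and only if $S$ is an involutive distribution and $d\omega|_{\wedge^3S\otimes\wedge^{p-1}TM}=0$.
   Context: On $E^p:=TM\oplus\wedge^pT^*M$ consider the $\wedge^{p-1}T^*M$-valued symmetric pairing $\langle X+\alpha,Y+\beta\rangle=\iota_X\beta+\iota_Y\alpha$ and, on sections, the Dorfman bracket $[\![X+\alpha,Y+\beta]\!]=[X,Y]+\mathcal{L}_X\beta-\iota_Yd\alpha$. The projection $E^p\to TM$ is denoted $pr_{TM}$. A (smooth) subbundle $L\subset E^p$ is Lagrangian if $L=L^\perp:=\{e\in E^p:\langle e,l\rangle=0\ \text{for all } l\in L \text{ over the same base point}\}$, and involutive if the Dorfman bracket of any two sections of $L$ is again a section of $L$. $S^\circ\subset T^*M$ denotes the annihilator of $S$. The condition $d\omega|_{\wedge^3S\otimes\wedge^{p-1}TM}=0$ means that $d\omega(X_1,X_2,X_3,Y_1,\dots,Y_{p-1})=0$ whenever $X_1,X_2,X_3\in S$ and $Y_1,\dots,Y_{p-1}\in TM$ (over the same point). (For every Lagrangian $L$ with $S$ of constant rank, a form $\omega$ describing $L$ as in the claim exists; it is in general not unique.) *)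

(* Defs.v *)
From HB Require Import structures.
From mathcomp Require Import all_boot all_order all_algebra.
From mathcomp Require Import all_classical all_reals all_analysis.
From mathcomp Require Import ring.
Import numFieldNormedType.Exports.
Import Order.TTheory GRing.Theory Num.Theory.

Set Implicit Arguments.
Unset Strict Implicit.
Unset Printing Implicit Defensive.

Local Open Scope classical_set_scope.
Local Open Scope ring_scope.

Section Alternating.
Context {R : realType} {V : lmodType R}.

Definition update k (u : 'I_k -> V) (i : 'I_k) (v : V) : 'I_k -> V :=
  fun j => if j == i then v else u j.

Definition multilinear k (a : ('I_k -> V) -> R) : Prop :=
  forall u i (c : R) v w,
    a (update u i (c *: v + w)) = c * a (update u i v) + a (update u i w).

Definition alternating k (a : ('I_k -> V) -> R) : Prop :=
  forall (u : 'I_k -> V) i j, i != j -> u i = u j -> a u = 0.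

Definition altform_pred k : {pred ('I_k -> V) -> R} :=
  fun a => `[< multilinear a /\ alternating a >].

Lemma altform_submod k : submod_closed (@altform_pred k).
Proof.
split.
  by apply/asboolP; split=> [u i c v w|u i j _ _]; rewrite /= ?mulr0 ?addr0.
move=> c a b /asboolP[al aa] /asboolP[bl ba].
apply/asboolP; split=> [u i d v w|u i j ij uij].
  by rewrite !fctE al bl /GRing.scale /=; ring.
by rewrite !fctE (aa u i j) ?(ba u i j) // scaler0 addr0.
Qed.

HB.instance Definition _ k :=
  GRing.isSubmodClosed.Build R (('I_k -> V) -> R) (@altform_pred k) (@altform_submod k).

Definition vcons k (v : V) (u : 'I_k -> V) : 'I_k.+1 -> V :=
  fun i => oapp u v (unlift ord0 i).

End Alternating.

Record altform (R : realType) (V : lmodType R) (k : nat) := AltForm {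
  altform_val :> ('I_k -> V) -> R ;
  _ : altform_val \in @altform_pred R V k }.

HB.instance Definition _ R V k := [isSub of @altform R V k for @altform_val R V k].
HB.instance Definition _ R V k := [Choice of @altform R V k by <:].
HB.instance Definition _ R V k := [SubChoice_isSubLmodule of @altform R V k by <:].

Section Contraction.
Context {R : realType} {V : lmodType R}.

Lemma update_vcons k (v w : V) (u : 'I_k -> V) i :
  vcons v (update u i w) = update (vcons v u) (lift ord0 i) w.
Proof.
by apply/funext => j; rewrite /vcons /update; case: unliftP => [l ->|->].
Qed.

Lemma contr_subproof k (v : V) (a : altform V k.+1) :
  (fun u => a (vcons v u)) \in @altform_pred R V k.
Proof.
have [al aa] : multilinear a /\ alternating a by case: a => a /= /asboolP.
apply/asboolP; split=> [u i c x y|u i j ij uij] /=.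
  by rewrite !update_vcons al.
by apply: (aa _ (lift ord0 i) (lift ord0 j)); rewrite ?(inj_eq lift_inj) // /vcons !liftK.
Qed.

Definition contr k (v : V) (a : altform V k.+1) : altform V k :=
  AltForm (contr_subproof v a).

(* The subspace [\wedge^k S^\circ] of [\wedge^k V^*]: the span of the wedge
   products of [k] covectors annihilating [S], where
   [(a_1 /\ ... /\ a_k) (v_1, ..., v_k) = det (a_i v_j)]. *)
Definition wedge_ann k (S : set V) : set (altform V k) :=
  [set b | exists (N : nat) (c : 'I_N -> R) (a : 'I_N -> 'I_k -> {scalar V}),
     (forall l i s, S s -> a l i s = 0) /\
     (forall u : 'I_k -> V,
        b u = \sum_(l < N) c l * \det (\matrix_(i, j) a l i (u j)))].

Definition is_basis k (b : 'I_k -> V) (W : set V) : Prop :=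
  W = range (fun c : 'I_k -> R => \sum_(i < k) c i *: b i) /\
  (forall c : 'I_k -> R, \sum_(i < k) c i *: b i = 0 -> forall i, c i = 0).

End Contraction.

Section EuclideanSmooth.
Context {R : realType} {n : nat}.
Implicit Types (U : set 'rV[R]_n) (f g : 'rV[R]_n -> R).

(* The set [U] is open wherever this is used. The definition asks for
   continuous iterated partial derivatives up to order [k]. *)
Fixpoint Ck (k : nat) U f : Prop :=
  (forall x, U x -> {for x, continuous f}) /\
  if k is k'.+1 then
    forall i : 'I_n, (forall x, U x -> derivable f x (delta_mx 0 i)) /\
                     Ck k' U ('D_(delta_mx 0 i) f)
  else True.

Definition Cinfty U f : Prop := forall k, Ck k U f.

Lemma Ck_cont k U f : Ck k U f -> forall x, U x -> {for x, continuous f}.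
Proof. by case: k => [|k] []. Qed.

Lemma CkW k U f : Ck k.+1 U f -> Ck k U f.
Proof.
elim: k f => [|k IH] f [fc fd]; split=> // i.
by split; [apply: (fd i).1 | apply: IH; exact: (fd i).2].
Qed.

Lemma Ck_eq k U f g : open U -> (forall x, U x -> f x = g x) -> Ck k U f -> Ck k U g.
Proof.
move=> oU; have near_eq (h h' : 'rV[R]_n -> R) x :
    (forall x, U x -> h x = h' x) -> U x -> \near x, h x = h' x.
  by move=> e Ux; apply: filterS (open_nbhs_nbhs (conj oU Ux)).
elim: k f g => [|k IH] f g fg [fc fd].
  split=> // x Ux; rewrite /prop_for /continuous_at -(fg x Ux).
  exact: cvg_trans (near_eq_cvg (near_eq _ _ _ fg Ux)) (fc x Ux).
split=> [x Ux|i].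
  rewrite /prop_for /continuous_at -(fg x Ux).
  exact: cvg_trans (near_eq_cvg (near_eq _ _ _ fg Ux)) (fc x Ux).
split=> [x Ux|].
  exact: near_eq_derivable (near_eq _ _ _ fg Ux) ((fd i).1 x Ux).
apply: IH (fd i).2 => x Ux; exact: near_eq_derive (near_eq _ _ _ fg Ux).
Qed.

Lemma Ck_cst k U (c : R) : Ck k U (cst c).
Proof.
elim: k c => [|k IH] c; split=> //; try by move=> x _; exact: cst_continuous.
move=> i.
split=> [x _|]; first exact: derivable_cst.
have -> : 'D_(delta_mx 0 i) (cst c : 'rV[R]_n -> R) = cst 0; last exact: IH.
by apply/funext => x; rewrite derive_cst.
Qed.

Lemma CkD k U f g : open U -> Ck k U f -> Ck k U g -> Ck k U (f + g).
Proof.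
move=> oU; elim: k f g => [|k IH] f g [fc fd] [gc gd].
  by split=> // x Ux; exact: continuousD (fc x Ux) (gc x Ux).
split=> [x Ux|i]; first by exact: continuousD (fc x Ux) (gc x Ux).
have [fdi fD] := fd i; have [gdi gD] := gd i.
split=> [x Ux|]; first by apply: derivableD; [exact: fdi|exact: gdi].
apply: (Ck_eq oU) (IH _ _ fD gD) => x Ux.
by rewrite deriveD; [|exact: fdi|exact: gdi].
Qed.

Lemma CkM k U f g : open U -> Ck k U f -> Ck k U g -> Ck k U (f * g).
Proof.
move=> oU; elim: k f g => [|k IH] f g Hf Hg.
  by split=> // x Ux; exact: continuousM (Ck_cont Hf Ux) (Ck_cont Hg Ux).
have [[fc fd] [gc gd]] := (Hf, Hg).
split=> [x Ux|i]; first by exact: continuousM (fc x Ux) (gc x Ux).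
have [fdi fD] := fd i; have [gdi gD] := gd i.
split=> [x Ux|]; first by apply: derivableM; [exact: fdi|exact: gdi].
apply: (Ck_eq oU) (CkD oU (IH _ _ (CkW Hf) gD) (IH _ _ (CkW Hg) fD)) => x Ux.
by rewrite deriveM; [|exact: fdi|exact: gdi].
Qed.

End EuclideanSmooth.

(* The map [cinv] is only meaningful on the image of the chart domain. *)
Record chart (R : realType) (n : nat) (T : topologicalType) := Chart {
  cdom : set T ;
  cmap : T -> 'rV[R]_n ;
  cinv : 'rV[R]_n -> T ;
  cdom_open : open cdom ;
  cimg_open : open (cmap @` cdom) ;
  cmapK : forall x, cdom x -> cinv (cmap x) = x ;
  cmap_continuous : forall x, cdom x -> {for x, continuous cmap} ;
  cinv_continuous : forall y, (cmap @` cdom) y -> {for y, continuous cinv} }.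

Record manifold (R : realType) (n : nat) := Manifold {
  points :> topologicalType ;
  manifold_hausdorff : hausdorff_space points ;
  manifold_second_countable : @second_countable points ;
  atlas : set (chart R n points) ;
  atlas_cover : forall x : points, exists2 c, atlas c & cdom c x ;
  atlas_compat : forall c d, atlas c -> atlas d -> forall i : 'I_n,
    Cinfty (cmap c @` (cdom c `&` cdom d))
           (fun y => cmap d (cinv c y) 0 i) }.

Section SmoothFunctions.
Context {R : realType} {n : nat} {M : manifold R n}.

Definition smooth_on (U : set M) (f : M -> R) : Prop :=
  forall c, atlas c ->
    Cinfty (cmap c @` cdom c `&` cinv c @^-1` U) (f \o cinv c).

Definition smooth_pred : {pred M -> R} := fun f => `[< smooth_on setT f >].

Lemma smooth_subring : subring_closed smooth_pred.
Proof.
have oI (c : chart R n M) : open (cmap c @` cdom c `&` cinv c @^-1` setT).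
  by rewrite preimage_setT setIT; exact: cimg_open.
have sM f g : f \in smooth_pred -> g \in smooth_pred -> f * g \in smooth_pred.
  move=> /asboolP Hf /asboolP Hg; apply/asboolP => c ac k.
  exact: (CkM (oI c) (Hf c ac k) (Hg c ac k)).
have sC (a : R) : cst a \in smooth_pred.
  by apply/asboolP => c ac k; exact: (Ck_cst k _ a).
split=> [|f g Hf Hg|f g Hf Hg]; [exact: sC| |exact: sM].
have : cst (-1) * g \in smooth_pred by apply: sM => //; exact: sC.
have -> : cst (-1) * g = - g by apply/funext => x; exact: mulN1r.
move: Hf => /asboolP Hf /asboolP Hg'; apply/asboolP => c ac k.
exact: (CkD (oI c) (Hf c ac k) (Hg' c ac k)).
Qed.

Lemma smooth_scale : GRing.scaler_closed smooth_pred.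
Proof.
move=> a f Hf.
have -> : a *: f = cst a * f by [].
have /asboolP Ha : cst a \in smooth_pred.
  by apply/asboolP => c ac k; exact: (Ck_cst k _ a).
have [_ _] := smooth_subring; apply => //; exact/asboolP.
Qed.

HB.instance Definition _ :=
  GRing.isSubringClosed.Build (M -> R) smooth_pred smooth_subring.
HB.instance Definition _ :=
  GRing.isScaleClosed.Build R (M -> R) smooth_pred smooth_scale.

End SmoothFunctions.

Record smoothfun (R : realType) (n : nat) (M : manifold R n) := SmoothFun {
  smoothfun_val :> M -> R ;
  _ : smoothfun_val \in @smooth_pred R n M }.

HB.instance Definition _ R n M := [isSub of @smoothfun R n M for @smoothfun_val R n M].
HB.instance Definition _ R n M := [Choice of @smoothfun R n M by <:].
HB.instance Definition _ R n M :=
  GRing.SubChoice_isSubComPzRing.Build _ _ (@smoothfun R n M) (subringClosedP _).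
HB.instance Definition _ R n M := [SubZmodule_isSubLmodule of @smoothfun R n M by <:].

Section TangentPred.
Context {R : realType} {n : nat} {M : manifold R n}.

Definition derivation_at (x : M) (v : smoothfun M -> R) : Prop :=
  (forall (a : R) f g, v (a *: f + g) = a * v f + v g) /\
  (forall f g, v (f * g) = v f * g x + f x * v g).

Definition derivation_pred (x : M) : {pred smoothfun M -> R} :=
  fun v => `[< derivation_at x v >].

Lemma derivation_submod x : submod_closed (derivation_pred x).
Proof.
split.
  by apply/asboolP; split=> [a f g|f g]; rewrite /= ?mulr0 ?mul0r addr0.
move=> c v w /asboolP[vl vd] /asboolP[wl wd].
apply/asboolP; split=> [a f g|f g]; rewrite !fctE /GRing.scale /=.
  by rewrite vl wl; ring.
by rewrite vd wd; ring.
Qed.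

HB.instance Definition _ x :=
  GRing.isSubmodClosed.Build R (smoothfun M -> R) (derivation_pred x) (derivation_submod x).

End TangentPred.

Record tangent (R : realType) (n : nat) (M : manifold R n) (x : M) := Tangent {
  tangent_val :> smoothfun M -> R ;
  _ : tangent_val \in derivation_pred x }.

HB.instance Definition _ R n M x := [isSub of @tangent R n M x for @tangent_val R n M x].
HB.instance Definition _ R n M x := [Choice of @tangent R n M x by <:].
HB.instance Definition _ R n M x := [SubChoice_isSubLmodule of @tangent R n M x by <:].

Section Fields.
Context {R : realType} {n : nat} {M : manifold R n}.

(* Fields and forms are tested against globally defined smooth functions and
   fields; by means of bump functions this also characterizes smoothness of
   their components in charts over an open set [U]. *)
Definition vfield_smooth_on (U : set M) (X : forall x : M, tangent x) : Prop :=
  forall f : smoothfun M, smooth_on U (fun x => X x f).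

Record vfield := VField {
  vfield_val :> forall x : M, tangent x ;
  vfieldP : vfield_smooth_on setT vfield_val }.

Definition form_smooth_on k (U : set M) (w : forall x : M, altform (tangent x) k) : Prop :=
  forall X : 'I_k -> vfield, smooth_on U (fun x => w x (fun i => X i x)).

Record diff_form k := Form {
  form_val :> forall x : M, altform (tangent x) k ;
  formP : form_smooth_on setT form_val }.

Lemma vapp_subproof (X : vfield) (f : smoothfun M) :
  (fun x => X x f) \in @smooth_pred R n M.
Proof. by apply/asboolP; exact: vfieldP. Qed.

Definition vapp (X : vfield) (f : smoothfun M) : smoothfun M :=
  SmoothFun (vapp_subproof X f).

Lemma feval_subproof k (w : diff_form k) (X : 'I_k -> vfield) :
  (fun x => w x (fun i => X i x)) \in @smooth_pred R n M.
Proof. by apply/asboolP; exact: formP. Qed.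

Definition feval k (w : diff_form k) (X : 'I_k -> vfield) : smoothfun M :=
  SmoothFun (feval_subproof w X).

Lemma tangentP (x : M) (v : tangent x) : derivation_at x v.
Proof. by case: v => v /= /asboolP. Qed.

Lemma vapp_lin X (a : R) f g : vapp X (a *: f + g) = a *: vapp X f + vapp X g.
Proof. by apply/val_inj/funext => x /=; rewrite (tangentP (X x)).1. Qed.

Lemma vapp_mul X f g : vapp X (f * g) = vapp X f * g + f * vapp X g.
Proof. by apply/val_inj/funext => x /=; rewrite (tangentP (X x)).2. Qed.

Lemma tangentD (x : M) (v : tangent x) f g : v (f + g) = v f + v g.
Proof. by rewrite -[f in LHS]scale1r (tangentP v).1 mul1r. Qed.

Lemma lie_derivation (X Y : vfield) x :
  (fun f => X x (vapp Y f) - Y x (vapp X f)) \in derivation_pred x.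
Proof.
apply/asboolP; split=> [a f g|f g].
  by rewrite !vapp_lin !(tangentP _).1; ring.
rewrite !vapp_mul !tangentD !(tangentP _).2 /=; ring.
Qed.

Definition lie (X Y : vfield) (x : M) : tangent x := Tangent (lie_derivation X Y x).

Lemma lie_smooth (X Y : vfield) : vfield_smooth_on setT (lie X Y).
Proof.
move=> f; suff -> : (fun x => lie X Y x f) =
    smoothfun_val (vapp X (vapp Y f) - vapp Y (vapp X f)).
  by case: (vapp X _ - _) => g /= /asboolP.
by apply/funext.
Qed.

Definition lie_bracket (X Y : vfield) : vfield := VField (@lie_smooth X Y).

(* [form_of F] is the differential form determined by its values
   [F X_0 ... X_(k-1)] on smooth vector fields. It exists and is unique as soon
   as [F] is alternating, multilinear over the smooth functions and takes smooth
   values, which is the case for the two maps to which it is applied below. *)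
Definition form_of k (F : ('I_k -> vfield) -> M -> R) (x : M) : altform (tangent x) k :=
  xget 0 [set a : altform (tangent x) k |
    forall X : 'I_k -> vfield, a (fun i => X i x) = F X x].

(* [d w (X_0, ..., X_k) = \sum_i (-1)^i X_i (w (.. X_i omitted ..))
     + \sum_(i < j) (-1)^(i + j) w ([X_i, X_j], .. X_i and X_j omitted ..)].
   In the second sum the bracket is left in the slot of [X_j], i.e. after the
   [j - 1] other arguments preceding it, so the sign becomes
   [(-1)^(i + j) (-1)^(j - 1) = - (-1)^i]. *)
Definition exterior_formula k (w : diff_form k) (X : 'I_k.+1 -> vfield) (x : M) : R :=
  \sum_(i < k.+1) (-1) ^+ i *
    (X i x (feval w (fun l => X (lift i l)))
     - \sum_(j < k.+1 | (i < j)%N)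
         w x (fun l => if lift i l == j then lie_bracket (X i) (X j) x
                       else X (lift i l) x)).

Definition ext_deriv k (w : diff_form k) : forall x : M, altform (tangent x) k.+1 :=
  form_of (exterior_formula w).

Definition lie_formula k (X : vfield) (w : diff_form k) (Y : 'I_k -> vfield) (x : M) : R :=
  X x (feval w Y)
  - \sum_(j < k) w x (fun l => if l == j then lie_bracket X (Y j) x else Y l x).

Definition lie_derivative k (X : vfield) (w : diff_form k) :
    forall x : M, altform (tangent x) k :=
  form_of (lie_formula X w).

Definition Ebundle (p : nat) (x : M) : lmodType R := (tangent x * altform (tangent x) p)%type.

(* Since the pairing takes values in [\wedge^(p-1) T^*M] and [p >= 1], the degree
   is written [p.+1]. *)
Definition pairing p (x : M) (e f : Ebundle p.+1 x) : altform (tangent x) p :=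
  contr e.1 f.2 + contr f.1 e.2.

Definition Esection (p : nat) : Type := (vfield * diff_form p)%type.

Definition Esection_at p (e : Esection p) (x : M) : Ebundle p x := (e.1 x, e.2 x).

Definition dorfman p (e f : Esection p) (x : M) : Ebundle p x :=
  (lie_bracket e.1 f.1 x,
   lie_derivative e.1 f.2 x - contr (f.1 x) (ext_deriv e.2 x)).

Definition smooth_subbundle p (L : forall x : M, set (Ebundle p x)) : Prop :=
  forall x : M, exists (U : set M) (r : nat) (b : 'I_r -> forall y : M, Ebundle p y),
    [/\ open U, U x,
        forall i, vfield_smooth_on U (fun y => (b i y).1) /\
                  form_smooth_on U (fun y => (b i y).2) &
        forall y, U y -> is_basis (fun i => b i y) (L y)].

Definition lagrangian p (L : forall x : M, set (Ebundle p.+1 x)) : Prop :=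
  forall x, L x = [set e | forall l, L x l -> pairing e l = 0].

(* Smoothness of [dorfman e f] is automatic, so that only membership is
   required. *)
Definition involutive_subbundle p (L : forall x : M, set (Ebundle p x)) : Prop :=
  forall e f : Esection p,
    (forall x, L x (Esection_at e x)) -> (forall x, L x (Esection_at f x)) ->
    forall x, L x (dorfman e f x).

Definition pr_tangent p (L : forall x : M, set (Ebundle p x)) (x : M) : set (tangent x) :=
  fst @` L x.

Definition constant_rank (S : forall x : M, set (tangent x)) : Prop :=
  exists r : nat, forall x, exists b : 'I_r -> tangent x, is_basis b (S x).

Definition involutive_distribution (S : forall x : M, set (tangent x)) : Prop :=
  forall X Y : vfield,
    (forall x, S x (X x)) -> (forall x, S x (Y x)) ->
    forall x, S x (lie_bracket X Y x).

End Fields.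

Arguments vfield {R n} M.
Arguments diff_form {R n} M k.
Arguments Ebundle {R n} M p x.
Arguments Esection {R n} M p.
Arguments pr_tangent {R n M p} L x _.

(* Main.v *)
Require Import Defs.
From HB Require Import structures.
From mathcomp Require Import all_boot all_order all_algebra.
From mathcomp Require Import all_classical all_reals all_analysis.
From mathcomp Require Import ring lra.

(** Why the theorem holds. Let [S = pr_TM L], and write sections of [L] as
    [e = A + i_A omega + alpha] and [f = B + i_B omega + beta], where the forms
    [alpha] and [beta] vanish as soon as one argument lies in [S]. The identities
    [L_A i_B - i_B L_A = i_[A,B]] and [L_A = d i_A + i_A d] give
      [[e, f]] = [A,B] + i_[A,B] omega
                 + (i_B i_A d omega + L_A beta - i_B d alpha).
    If [L] is involutive, take [alpha = beta = 0]: then [[A,B]] must lie in [S], and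
    [i_B i_A d omega] must be a combination of wedge products of covectors
    annihilating [S], so that it vanishes as soon as one argument lies in [S].
    Conversely, if [S] is involutive, then contracting [L_A beta] or [i_B d alpha]
    with a field of [S] gives zero, because in the invariant formulas every term
    has an argument in [S] ([lie_formula_basic], [exterior_formula_basic]); what is
    left of the last bracket is [d omega] on three vectors of [S]
    ([dorfman_defect]). Since [L = L^perp], a bracket lies in [L] as soon as its
    pairings with the elements of [L] vanish, and this only requires that its last
    term be killed by contraction with vectors of [S]. Vectors of [S] extend to
    global sections of [S] by multiplying a local frame of [L] with a bump function
    ([pr_tangent_section]).

    The rest of the file is the calculus behind these identities. The forms
    [d omega] and [L_A beta] are defined as the alternating forms that have
    prescribed values on vector fields. Such forms exist ([form_ofE]) because every
    tangent vector extends to a vector field and because the invariant formulas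
    are linear over the smooth functions in each field, hence depend only on the
    values of the fields at the point considered. Both facts rest on [local_frame]:
    near a given point, every tangent vector [v] is the combination of finitely many
    global vector fields whose coefficients are obtained by applying [v] to fixed
    smooth functions. Linearity of the exterior derivative in its fields is proved
    by induction on the degree, from Cartan's formula
    [(d w)(A, X) = (L_A w)(X) - (d (i_A w))(X)], which the invariant formula
    satisfies term by term.

    Tangent vectors are derivations of the algebra of global smooth functions, so
    [local_frame] says that a derivation at [y] only sees the partial derivatives
    at [y]. This is Hadamard's lemma, [f z = f y + sum_j (z_j - y_j) h_j z] with
    smooth [h_j], combined with bump functions that make this expansion global. The
    functions [h_j] are the means of the partial derivatives of [f] along the
    segments from [y]; they are smooth by differentiation under the integral. The
    chain rule carries smoothness in one chart over to the other charts; it requires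
    that functions with continuous partial derivatives be differentiable. *)

Import numFieldNormedType.Exports.
Import Order.TTheory GRing.Theory Num.Theory.

Set Implicit Arguments.
Unset Strict Implicit.
Unset Printing Implicit Defensive.

Local Open Scope classical_set_scope.
Local Open Scope ring_scope.

(** * Functions with continuous partial derivatives are differentiable *)

Lemma continuous_for_sum {R : realType} {T : topologicalType} (x : T) (I : Type)
    (r : seq I) (F : I -> T -> R) :
  (forall i, {for x, continuous (F i)}) ->
  {for x, continuous (fun y => \sum_(i <- r) F i y)}.
Proof.
move=> cF; apply: (@cvg_big R _ +%R 0 xpredT) => [|i _]; last exact: cF.
exact: (@pseudometric_normed_Zmodule.add_continuous R R^o).
Qed.

Section ContinuouslyDifferentiable.
Context {R : realType} {n : nat}.
Implicit Types (U : set 'rV[R]_n) (f g : 'rV[R]_n -> R).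

Lemma is_derive_line f (y e : 'rV[R]_n) (s : R) :
  derivable f (y + s *: e) e ->
  is_derive s 1 (fun t : R => f (y + t *: e)) ('D_e f (y + s *: e)).
Proof.
move=> df; have E : (fun h : R => h^-1 *: (((fun t : R => f (y + t *: e)) \o shift s)
      (h *: 1) - f (y + s *: e))) =
  (fun h => h^-1 *: ((f \o shift (y + s *: e)) (h *: e) - f (y + s *: e))).
  apply/funext => h /=; congr (_ *: (f _ - _)).
  by rewrite [h *: 1]mulr1 scalerDl addrCA.
by split; rewrite /derivable /derive E.
Qed.

(** The mean value theorem on a segment in the direction [e], as an estimate. *)
Lemma line_mvt f (y e : 'rV[R]_n) (c d eps : R) :
  (forall s : R, `|s| <= `|c| -> derivable f (y + s *: e) e /\
     `|'D_e f (y + s *: e) - d| <= eps) ->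
  `|f (y + c *: e) - f y - c * d| <= eps * `|c|.
Proof.
move=> H.
have der (s : R) : `|s| <= `|c| ->
    is_derive s 1 (fun t : R => f (y + t *: e)) ('D_e f (y + s *: e)).
  by move=> /H[? _]; exact: is_derive_line.
have cont (a b : R) : (forall s : R, s \in `[a, b] -> `|s| <= `|c|) ->
    {within `[a, b], continuous (fun t : R => f (y + t *: e))}.
  by move=> ab; apply: derivable_within_continuous => s /ab /der[].
have key (a b : R) : a <= b -> (forall s : R, s \in `[a, b] -> `|s| <= `|c|) ->
    `|f (y + b *: e) - f (y + a *: e) - (b - a) * d| <= eps * (b - a).
  move=> leab ab.
  have dab (s : R) : s \in `]a, b[ ->
      is_derive s 1 (fun t : R => f (y + t *: e)) ('D_e f (y + s *: e)).
    by move=> /subset_itv_oo_cc sab; exact/der/ab.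
  have [s sab ->] := MVT_segment leab dab (cont a b ab).
  rewrite [X in _ - X]mulrC -mulrBl normrM (ger0_norm (x := b - a)) ?subr_ge0//.
  by apply: ler_wpM2r; rewrite ?subr_ge0//; have [] := H s (ab s sab).
have [c0|c0] := leP 0 c.
  have := key 0 c c0; rewrite scale0r addr0 subr0 (ger0_norm c0); apply => s.
  by rewrite in_itv /= => /andP[s0 sc]; rewrite (ger0_norm s0).
have := key c 0 (ltW c0); rewrite scale0r addr0 sub0r (ltr0_norm c0).
rewrite -normrN; set u := (X in `|X|); set v := (X in _ -> `|X| <= _).
have -> : u = v by rewrite /u /v; ring.
apply => s; rewrite in_itv /= => /andP[cs s0].
by rewrite (ler0_norm s0) lerN2.
Qed.

Let trunc (h : 'rV[R]_n) (k : nat) : 'rV[R]_n :=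
  \row_j (if (j < k)%N then h 0 j else 0).

Lemma row_norm_le (h : 'rV[R]_n) (e : R) : 0 <= e ->
  (forall j, `|h 0 j| <= e) -> `|h| <= e.
Proof.
move=> e0 he; rewrite /Num.Def.normr/= mx_normrE; apply: bigmax_le => // -[i j] _.
by rewrite ord1 /=; exact: he.
Qed.

Lemma row_coord_le (h : 'rV[R]_n) j : `|h 0 j| <= `|h|.
Proof.
by rewrite [leRHS]/Num.Def.normr/= mx_normrE (le_bigmax _ _ (ord0, j)).
Qed.

Definition grad f x (h : 'rV[R]_n) : R := \sum_j h 0 j * 'D_(delta_mx 0 j) f x.

Lemma grad_linear f x : linear (grad f x : 'rV[R]_n -> R^o).
Proof.
move=> a u v; rewrite /grad -[RHS]/(a * _ + _) mulr_sumr -big_split /=.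
by apply: eq_bigr => j _; rewrite !mxE; ring.
Qed.
HB.instance Definition _ f x :=
  GRing.isLinear.Build _ _ _ _ (grad f x : _ -> R^o) (grad_linear f x).

Lemma grad_continuous f x : continuous (grad f x).
Proof.
move=> h; apply: continuous_for_sum => j.
have cj : {for h, continuous (fun z : 'rV[R]_n => z 0 j)} := @coord_continuous R 1 n 0 j h.
exact: continuousM cj (@cst_continuous _ _ ('D_(delta_mx 0 j) f x) h).
Qed.

(** Going from [x] to [x + h] along the coordinate axes, the mean value theorem
    bounds the error of each step by the oscillation of one partial derivative
    near [x]. *)
Lemma C1_is_diff U f x : open U -> Ck 1 U f -> U x -> is_diff x f (grad f x).
Proof.
move=> oU C1 Ux; have [fc fd] := C1.
suff E : (f : 'rV[R]_n -> R^o) \o shift x =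
    cst (f x : R^o) + (grad f x : 'rV[R]_n -> R^o) +o_ (0 : 'rV[R]_n) id.
  have D : 'd f x = grad f x :> (_ -> _).
    by rewrite (@diff_unique _ _ R^o f (grad f x) x) //; exact: grad_continuous.
  by split => //; apply/diff_locallyP; rewrite D; split => //; exact: grad_continuous.
apply/eqaddoP => e e0.
have n0 : 0 < n.+1%:R :> R by [].
(* There are [n] steps, each contributing at most [e' * `|h|]; dividing by
   [n.+1] also covers [n = 0]. *)
set e' := e / n.+1%:R; have e'0 : 0 < e' by rewrite divr_gt0.
have : \forall z \near x, U z /\ forall j : 'I_n,
     `|'D_(delta_mx 0 j) f z - 'D_(delta_mx 0 j) f x| <= e'.
  apply: filterI; first exact: (open_nbhs_nbhs (conj oU Ux)).
  apply: (@filter_forall _ _ _ (nbhs x)) => j.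
  have /= := (fd j).2.1 x Ux; move/cvgrPdist_le => /(_ _ e'0).
  by apply: filterS => z; rewrite distrC.
move=> /nbhs_ballP[r /= r0 Hr].
apply: (filterS _ (nbhsx_ballx (0 : 'rV[R]_n) r r0)) => h /=.
rewrite -ball_normE /= sub0r normrN => hr.
have T k s (j : 'I_n) : k = j -> `|s| <= `|h 0 j| ->
    `|trunc h k + s *: delta_mx 0 j| < r.
  move=> -> sh; apply: le_lt_trans hr; apply: row_norm_le => // i.
  rewrite !mxE eqxx /=; have [->|ij] := eqVneq i j.
    by rewrite ltnn add0r mulr1 (le_trans sh) // row_coord_le.
  rewrite mulr0 addr0; case: ifP => _; first exact: row_coord_le.
  by rewrite normr0.
have step (k : 'I_n) : `|f (x + trunc h k.+1) - f (x + trunc h k) -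
    h 0 k * 'D_(delta_mx 0 k) f x| <= e' * `|h|.
  have -> : x + trunc h k.+1 = (x + trunc h k) + h 0 k *: delta_mx 0 k.
    rewrite -addrA; congr (_ + _); apply/rowP => i; rewrite !mxE eqxx /=.
    rewrite ltnS; have [->|ik] := eqVneq i k; first by rewrite leqnn ltnn add0r mulr1.
    by rewrite leq_eqVlt val_eqE (negPf ik) mulr0 addr0.
  apply: le_trans (_ : e' * `|h 0 k| <= _).
    apply: line_mvt => s sh; have := T k s k erefl sh => Tr.
    have /Hr[Uz Dz] : ball x r (x + trunc h k + s *: delta_mx 0 k).
      by rewrite -ball_normE /= -addrA opprD addrA subrr sub0r normrN.
    by split; [exact: (fd k).1 | exact: Dz].
  by apply: ler_wpM2l; [exact: ltW | exact: row_coord_le].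
(* Moving from [x] to [x + h] one coordinate at a time. *)
have tele : forall k, (k <= n)%N ->
    `|f (x + trunc h k) - f x - \sum_(j < n | (j < k)%N) h 0 j * 'D_(delta_mx 0 j) f x|
    <= k%:R * (e' * `|h|).
  elim=> [_|k IH kn].
    have -> : trunc h 0 = 0 by apply/rowP => i; rewrite !mxE.
    by rewrite addr0 subrr big_pred0 // subr0 normr0 mul0r.
  rewrite (bigD1 (Ordinal kn)) //=.
  have -> : \sum_(i < n | (i < k.+1)%N && (i != Ordinal kn)) h 0 i * 'D_(delta_mx 0 i) f x
     = \sum_(j < n | (j < k)%N) h 0 j * 'D_(delta_mx 0 j) f x.
    by apply: eq_bigl => i; rewrite ltnS -val_eqE /= [(i < k)%N]ltn_neqAle andbC.
  have := step (Ordinal kn); have := IH (ltnW kn) => /= A B.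
  rewrite [X in _ <= X](_ : _ = k%:R * (e' * `|h|) + e' * `|h|); last by rewrite -natr1; ring.
  set P := (Z in `|Z| <= _) in A; set Q := (Z in `|Z| <= _) in B.
  set W := (Z in `|Z| <= _); have -> : W = P + Q.
    by rewrite /W /P /Q; ring.
  by apply: le_trans (ler_normD _ _) (lerD A B).
have := tele n (leqnn n).
have -> : trunc h n = h by apply/rowP => i; rewrite !mxE ltn_ord.
under eq_bigl do rewrite ltn_ord.
rewrite -/(grad f x h) /= => A.
rewrite !fctE /= [h + x]addrC opprD addrA; apply: le_trans A _.
rewrite mulrA ler_wpM2r // /e' mulrCA ger_pMr // ler_pdivrMr // mul1r ler_nat.
exact: leqnSn.
Qed.

End ContinuouslyDifferentiable.

(** * Functions of class C^k: locality, operations, chain rule *)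

Section CkTheory.
Context {R : realType} {n : nat}.
Implicit Types (U : set 'rV[R]_n) (f g : 'rV[R]_n -> R).

Lemma Ck_le k l U f : (k <= l)%N -> Ck l U f -> Ck k U f.
Proof. by move=> /subnK <-; elim: (l - k)%N => [|i IH] //= /CkW. Qed.

Lemma Ck_subset k U V f : U `<=` V -> Ck k V f -> Ck k U f.
Proof.
move=> UV; elim: k f => [|k IH] f [fc fd]; first by split=> // x /UV/fc.
split=> [x /UV/fc //|i].
by have [d c] := fd i; split=> [x /UV/d|] //; exact: IH.
Qed.

(** Membership in [Ck] is a condition at each point, because the partial
    derivatives are those of the globally defined function. *)
Lemma Ck_setU k U V f : Ck k U f -> Ck k V f -> Ck k (U `|` V) f.
Proof.
elim: k f => [|k IH] f [fc fd] [gc gd].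
  by split=> // x [/fc|/gc].
split=> [x [/fc|/gc] //|i]; have [d c] := fd i; have [d' c'] := gd i.
by split=> [x [/d|/d'] //|]; exact: IH.
Qed.

Lemma Ck_sum k U (I : Type) (r : seq I) (F : I -> 'rV[R]_n -> R) : open U ->
  (forall i, Ck k U (F i)) -> Ck k U (fun x => \sum_(i <- r) F i x).
Proof.
move=> oU FC; elim: r => [|i r IH].
  by under eq_fun do rewrite big_nil; exact: Ck_cst.
under eq_fun do rewrite big_cons; exact: CkD.
Qed.

Lemma CkN k U f : open U -> Ck k U f -> Ck k U (fun x => - f x).
Proof.
move=> oU Cf; have := CkM oU (Ck_cst k U (-1)) Cf.
by congr Ck; apply/funext => x; rewrite /= -[LHS]/(-1 * f x) mulN1r.
Qed.

Lemma CkB k U f g : open U -> Ck k U f -> Ck k U g -> Ck k U (fun x => f x - g x).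
Proof. by move=> oU Cf Cg; exact: CkD oU Cf (CkN oU Cg). Qed.

Lemma is_derive_coord (x : 'rV[R]_n) (v : 'rV[R]_n) j :
  is_derive x v (fun z : 'rV[R]_n => z 0 j) (v 0 j).
Proof.
have E : \forall h \near 0^', (v 0 j : R^o) =
    h^-1 *: (((fun z : 'rV[R]_n => z 0 j) \o shift x) (h *: v) - x 0 j).
  near=> h; rewrite /= !mxE addrK [RHS]mulrA mulVf ?mul1r //.
  by near: h; exact: nbhs_dnbhs_neq.
have C := cvg_trans (near_eq_cvg E) (cvg_cst (v 0 j : R^o)).
have {}C := C _ _; split; last by apply: cvg_lim => //; exact: C.
by apply/cvg_ex; exists (v 0 j); exact: C.
Unshelve. all: by end_near. Qed.

Lemma Ck_coord k U j : Ck k U (fun z => z 0 j).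
Proof.
case: k => [|k]; first by split=> // x _; exact: coord_continuous.
split=> [x _|i]; first exact: coord_continuous.
split=> [x _|]; first by have [] := is_derive_coord x (delta_mx 0 i) j.
rewrite (_ : 'D_(delta_mx 0 i) _ = cst ((delta_mx 0 i : 'rV[R]_n) 0 j)); first exact: Ck_cst.
apply/funext => x.
exact: (@derive_val _ _ _ _ _ _ _ (is_derive_coord x (delta_mx 0 i) j)).
Qed.

Lemma continuous_row {T : topologicalType} (phi : T -> 'rV[R]_n) (x : T) :
  (forall i, {for x, continuous (fun y => phi y 0 i)}) -> {for x, continuous phi}.
Proof.
move=> pc; apply/cvgrPdist_le => e e0.
suff : \forall y \near x, forall i, `|phi x 0 i - phi y 0 i| <= e.
  apply: filterS => y H; apply: row_norm_le (ltW e0) _ => j.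
  by rewrite !mxE; exact: H.
apply: (@filter_forall _ _ _ (nbhs x)) => i.
by have /cvgrPdist_le := pc i; exact.
Qed.

End CkTheory.

Lemma derive_line {R : realType} {V W : normedModType R} (F : V -> W) x v :
  'D_v F x = 'D_1 (fun h : R => F (h *: v + x)) (0 : R).
Proof.
rewrite /derive; set g1 := fun h => h^-1 *: _; set g2 := fun h => h^-1 *: _.
suff -> : g1 = g2 by [].
by rewrite funeqE /g1 /g2 => h /=; rewrite addr0 scale0r add0r [_%:A]mulr1.
Qed.

Section ChainRule.
Context {R : realType} {m n : nat}.

(** Only the outer function has to be differentiable: the inner one is restricted
    to a line, where directional derivability is differentiability. *)
Lemma C1_is_derive_comp (V : set 'rV[R]_m) (f : 'rV[R]_m -> R)
    (phi : 'rV[R]_n -> 'rV[R]_m) x v :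
  open V -> Ck 1 V f -> V (phi x) ->
  (forall j, derivable (fun y => phi y 0 j) x v) ->
  is_derive x v (f \o phi) (\sum_j 'D_v (fun y => phi y 0 j) x * 'D_(delta_mx 0 j) f (phi x)).
Proof.
move=> oV Cf Vx dphi.
have dp : derivable phi x v by apply/derivable_mxP => i j; rewrite ord1; exact: dphi.
set g := fun h : R => phi (h *: v + x).
have g0 : g 0 = phi x by rewrite /g scale0r add0r.
have dg : differentiable g (0 : R).
  by apply/derivable1_diffP; exact: (derivable1P phi x v).1 dp.
rewrite -g0 in Vx; have [df Df] := C1_is_diff oV Cf Vx.
have dfg := differentiable_comp dg df.
have dfphi : derivable (f \o phi) x v.
  apply: (derivable1P (f \o phi) x v).2.
  exact: ((@derivable1_diffP R R^o (f \o g) 0).2 dfg).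
split => //.
rewrite (derive_line (f \o phi) x v) -/(f \o g).
rewrite deriveE // diff_comp //= Df -deriveE //.
rewrite -(derive_line phi x v).
rewrite /grad g0; apply: eq_bigr => j _; rewrite derive_mx //.
by rewrite mxE.
Qed.

Lemma Ck_comp k (U : set 'rV[R]_n) (V : set 'rV[R]_m) (f : 'rV[R]_m -> R)
    (phi : 'rV[R]_n -> 'rV[R]_m) :
  open U -> open V -> (forall x, U x -> V (phi x)) ->
  (forall j, Ck k U (fun y => phi y 0 j)) -> Ck k V f -> Ck k U (f \o phi).
Proof.
move=> oU oV UV; elim: k f => [|k IH] f Cp Cf.
all: have cont x : U x -> {for x, continuous (f \o phi)}
  by move=> Ux; apply: continuous_comp;
     [apply: continuous_row => i; exact: (Ck_cont (Cp i) Ux)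
     | exact: (Ck_cont Cf (UV _ Ux))].
  by split.
split=> // i.
have D x : U x -> is_derive x (delta_mx 0 i) (f \o phi)
    (\sum_j 'D_(delta_mx 0 i) (fun y => phi y 0 j) x * 'D_(delta_mx 0 j) f (phi x)).
  move=> Ux; apply: (C1_is_derive_comp oV (Ck_le _ Cf) (UV _ Ux)) => // j.
  by have [_ /(_ i)[]] := Cp j => + _; exact.
split=> [x /D[] //|].
apply: (@Ck_eq _ _ _ _ (fun x => \sum_j
    'D_(delta_mx 0 i) (fun y => phi y 0 j) x * 'D_(delta_mx 0 j) f (phi x))) => //.
  by move=> x /D[_ ->].
apply: Ck_sum => // j; apply: CkM => //.
  by have [_ /(_ i)[]] := Cp j.
apply: (IH ('D_(delta_mx 0 j) f)) => [l|]; first exact/CkW/Cp.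
by have [_ /(_ j)[]] := Cf.
Qed.
End ChainRule.

(** * The flat function exp(-1/t) and its derivatives *)

Section Flat.
Context {R : realType}.

(** [flat 0] is the function [exp (- 1 / t)], extended by [0] to [t <= 0]. The
    derivative of a member of the family is a combination of two other members, so
    that one computation shows that all of them are smooth. *)
Definition flat (m : nat) (t : R) : R :=
  if 0 < t then (t^-1) ^+ m * expR (- t^-1) else 0.

Lemma flat_ge0 m t : 0 <= flat m t.
Proof.
rewrite /flat; case: ifP => // t0.
by rewrite mulr_ge0 ?expR_ge0 // exprn_ge0 // invr_ge0 ltW.
Qed.

(** From [u ^ (m+1) <= (m+1)! exp u] at [u = 1 / t]. *)
Lemma flat_le m t : `|flat m t| <= (m.+1)`!%:R * `|t|.
Proof.
rewrite (ger0_norm (flat_ge0 m t)) /flat; case: ifPn => [t0|_]; last first.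
  by rewrite mulr_ge0.
have t'0 : 0 < t^-1 by rewrite invr_gt0.
have H : (t^-1) ^+ m.+1 / (m.+1)`!%:R <= expR t^-1.
  by have := expR_ge1Dxn m (ltW t'0); apply: le_trans; rewrite lerDr.
have F0 : 0 < (m.+1)`!%:R :> R by rewrite ltr0n fact_gt0.
rewrite (gtr0_norm t0) expRN ler_pdivrMr ?expR_gt0 // -ler_pdivrMl ?mulr_gt0 //.
apply: le_trans _ H; rewrite exprS invfM.
by rewrite -mulrA mulrC [leRHS]mulrC -mulrA.
Qed.

Lemma flat_div m t : t != 0 -> t^-1 * flat m t = flat m.+1 t.
Proof. by rewrite /flat; case: ifP => _ t0; rewrite ?mulr0 // exprS mulrA. Qed.

(** At [0] the difference quotient of [flat m] is [flat m.+1], which tends to [0]. *)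
Lemma is_derive_flat m (t : R) :
  is_derive t 1 (flat m) (flat m.+2 t - m%:R * flat m.+1 t).
Proof.
have [t0|t0|->] := ltgtP t 0.
- rewrite /flat [0 < t]ltNge (ltW t0) /= mulr0 subr0.
  apply: (near_eq_is_derive _ (is_derive_cst (0 : R^o) t 1)).
  near=> s; rewrite /= ifF //; apply/negbTE; rewrite -leNgt.
  by apply: ltW; near: s; exact: lt_nbhsl.
- have tn : t != 0 by rewrite gt_eqF.
  have di : is_derive t 1 (fun s : R => s^-1) (- t^-1 ^+ 2).
    have := @is_deriveV R idfun t 1 1 tn (is_derive_id _ _).
    by rewrite exprVn [_ *: _]mulr1.
  have de := @is_derive1_comp R expR (fun s => - s^-1) t _ _
    (is_derive_expR (- t^-1)) (is_deriveN di).
  have H := is_deriveM (is_deriveX m di) de.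
  have E : \near t,
      ((fun s : R => s^-1) ^+ m * (expR \o (fun s => - s^-1))) t = flat m t.
    near=> s; rewrite /flat ifT; last by near: s; exact: lt_nbhsr.
    by rewrite !fctE.
  have [d e] := near_eq_is_derive E H.
  split => //; rewrite e /flat t0.
  rewrite /GRing.scale /= !fctE.
  by case: m {E H d e} => [|m]; rewrite ?exprS ?expr0 /=; ring.
have f0 k : flat k 0 = 0 by rewrite /flat ltxx.
rewrite !f0 mulr0 subr0.
have C : h^-1 *: ((flat m \o shift (0 : R)) (h *: 1) - flat m 0 : R^o)
    @[h --> (0 : R)^'] --> (0 : R^o).
  apply/cvgrPdist_le => e e0.
  have F0 : 0 < (m.+2)`!%:R :> R by rewrite ltr0n fact_gt0.
  near=> h; rewrite /= f0 subr0 sub0r normrN addr0 [h *: 1]mulr1.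
  rewrite -[X in `|X|]/(h^-1 * _) flat_div; last by near: h; exact: nbhs_dnbhs_neq.
  apply: le_trans (flat_le _ _) _; rewrite -ler_pdivlMl //.
  near: h; apply: dnbhs0_le; by rewrite mulr_gt0 ?invr_gt0.
by split; [apply/cvg_ex; exists 0; exact: C | apply: cvg_lim => //; exact: C].
Unshelve. all: by end_near. Qed.

Lemma Ck_flat n k m (U : set 'rV[R]_n) g : open U -> Ck k U g -> Ck k U (flat m \o g).
Proof.
move=> oU; have fc i : continuous (flat i).
  move=> t; apply/differentiable_continuous/derivable1_diffP.
  by case: (is_derive_flat i t).
elim: k m g => [|k IH] m g Cg.
  by split=> // x Ux; apply: continuous_comp (Ck_cont Cg Ux) _; exact: fc.
split=> [x Ux|i]; first by apply: continuous_comp (Ck_cont Cg Ux) _; exact: fc.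
have D x : U x -> is_derive x (delta_mx 0 i) (flat m \o g)
    ((flat m.+2 (g x) - m%:R * flat m.+1 (g x)) * 'D_(delta_mx 0 i) g x).
  move=> Ux; have [_ /(_ i)[/(_ x Ux) dg _]] := Cg.
  have g0 : g x = (fun h : R => g (h *: delta_mx 0 i + x)) 0.
    by rewrite scale0r add0r.
  have dl : is_derive (0 : R) 1 (fun h : R => g (h *: delta_mx 0 i + x)) ('D_(delta_mx 0 i) g x).
    by split; [exact/(derivable1P g x (delta_mx 0 i)).1 | rewrite -derive_line].
  have := is_derive_flat m (g x); rewrite {1}g0 => df.
  have [d e] := is_derive1_comp df dl.
  split; first exact: (derivable1P (flat m \o g) x (delta_mx 0 i)).2 d.
  by rewrite derive_line -[RHS]e.
split=> [x /D[] //|].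
have [_ /(_ i)[_ Cdg]] := Cg.
apply: (@Ck_eq _ _ _ _ (fun x =>
    (flat m.+2 (g x) - m%:R * flat m.+1 (g x)) * 'D_(delta_mx 0 i) g x)) => //.
  by move=> x /D[_ ->].
apply: CkM => //; apply: CkB => //; first exact/IH/CkW.
by apply: (CkM oU (Ck_cst k U m%:R)); exact/IH/CkW.
Qed.
End Flat.

(** * Hadamard's lemma *)

Section UnitInterval.
Context {R : realType}.
Local Notation mu := (@lebesgue_measure R).
Implicit Types f g : R -> R.

Lemma mu01 : fine (mu `[0, 1]) = 1.
Proof. by rewrite lebesgue_measure_itv /= lte_fin ltr01 oppr0 adde0. Qed.

Lemma cont01_integrable f : (forall t, t \in `[0, 1] -> {for t, continuous f}) ->
  mu.-integrable `[0, 1] (EFin \o f).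
Proof.
move=> cf; apply: continuous_compact_integrable; first exact: segment_compact.
by apply: continuous_in_subspaceT => t /[!inE] /= tt; exact: cf.
Qed.

(** The only estimate on integrals that the continuity and the derivatives of
    [radial_mean] need. *)
Lemma int01_dist f g e : (forall t, t \in `[0, 1] -> {for t, continuous f}) ->
  (forall t, t \in `[0, 1] -> {for t, continuous g}) ->
  (forall t, t \in `[0, 1] -> `|f t - g t| <= e) ->
  `|\int[mu]_(t in `[0, 1]) f t - \int[mu]_(t in `[0, 1]) g t| <= e.
Proof.
move=> cf cg fg.
have If := cont01_integrable cf; have Ig := cont01_integrable cg.
have cfg t : t \in `[0, 1] -> {for t, continuous (fun s => f s - g s)}.
  by move=> tt; exact: (@continuousB _ R^o _ _ _ _ (cf t tt) (cg t tt)).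
rewrite -RintegralB //; apply: le_trans (le_normr_Rintegral _ (cont01_integrable cfg)) _ => //.
have -> : e = \int[mu]_(_ in `[0, 1]) e by rewrite Rintegral_cst // mu01 mulr1.
apply: (@le_Rintegral _ _ _ mu `[0, 1]%classic (fun t => `|f t - g t|) (cst e)) => //.
  apply: (@cont01_integrable (fun t => `|f t - g t|)) => t tt.
  apply: (@continuous_comp _ _ _ (fun t => f t - g t) (fun y : R => `|y|)); first exact: cfg.
  exact: (@norm_continuous _ R^o).
by apply: (@cont01_integrable (cst e)) => t tt; exact: cst_continuous.
Qed.

Lemma int01_sum (I : Type) (r : seq I) (F : I -> R -> R) :
  (forall i t, t \in `[0, 1] -> {for t, continuous (F i)}) ->
  \int[mu]_(t in `[0, 1]) (\sum_(i <- r) F i t) =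
  \sum_(i <- r) \int[mu]_(t in `[0, 1]) F i t.
Proof.
move=> cF.
have cS s t : t \in `[0, 1] -> {for t, continuous (fun t => \sum_(i <- s) F i t)}.
  by move=> tt; apply: continuous_for_sum => i; exact: cF.
elim: r => [|i r IH].
  under eq_Rintegral do rewrite big_nil.
  by rewrite big_nil Rintegral_cst // mul0r.
under eq_Rintegral do rewrite big_cons.
rewrite big_cons -IH RintegralD //.
  by apply: cont01_integrable => t; exact: cF.
by apply: cont01_integrable => t; exact: cS.
Qed.

End UnitInterval.

Section Hadamard.
Context {R : realType} {n : nat}.
Local Notation mu := (@lebesgue_measure R).
Context (U : set 'rV[R]_n) (a : 'rV[R]_n) (oU : open U).
Context (starU : forall z (t : R), U z -> t \in `[0, 1] -> U (a + t *: (z - a))).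

(** Uniformity in [t] comes from the compactness of [[0, 1]]. *)
Lemma seg_near (g : 'rV[R]_n -> R) (z0 : 'rV[R]_n) (e : R) :
  (forall x, U x -> {for x, continuous g}) -> U z0 -> 0 < e ->
  \forall z \near z0, forall t : R, t \in `[0, 1] ->
    U (a + t *: (z - a)) /\ `|g (a + t *: (z - a)) - g (a + t *: (z0 - a))| <= e.
Proof.
move=> cg Uz0 e0.
have /compact_near_coveringP cov := @segment_compact R 0 1.
apply: (cov _ (nbhs z0) (fun z t => U (a + t *: (z - a)) /\
    `|g (a + t *: (z - a)) - g (a + t *: (z0 - a))| <= e)) => t0 /= tt.
set y0 := a + t0 *: (z0 - a).
have Uy0 : U y0 by exact: starU.
have segc (w : 'rV[R]_n) : (a + s.1 *: (s.2 - a)) @[s --> (t0, w)] --> a + t0 *: (w - a).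
  apply: cvgD; first exact: cvg_cst.
  apply: cvgZ; first exact: cvg_fst.
  by apply: cvgB; [exact: cvg_snd | exact: cvg_cst].
have near1 : \forall y \near y0, U y /\ `|g y - g y0| <= e / 2.
  apply: filterI; first exact: (open_nbhs_nbhs (conj oU Uy0)).
  have /cvgrPdist_le/(_ (e / 2)) := cg _ Uy0.
  by rewrite divr_gt0 // => /(_ isT); apply: filterS => y; rewrite distrC.
have N1 : \forall s \near ((t0, z0) : R * 'rV[R]_n),
   U (a + s.1 *: (s.2 - a)) /\ `|g (a + s.1 *: (s.2 - a)) - g y0| <= e / 2.
  exact: segc near1.
have N2 : \forall s \near t0, `|g (a + s *: (z0 - a)) - g y0| <= e / 2.
  have seg1 : (a + s *: (z0 - a)) @[s --> t0] --> y0.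
    apply: cvgD; first exact: cvg_cst.
    by apply: cvgZr_tmp; exact: cvg_id.
  have N : nbhs t0 ((fun s : R => a + s *: (z0 - a)) @^-1`
      [set y | U y /\ `|g y - g y0| <= e / 2]) := seg1 _ near1.
  by apply: filterS N => s [].
have [[A B] /= [At0 Bz0] AB] := N1.
exists (A `&` [set s | `|g (a + s *: (z0 - a)) - g y0| <= e / 2], B).
  by split => //; exact: filterI.
case=> s z /= [[As gs] Bz]; have [/= Uz gz] := AB (s, z) (conj As Bz).
split=> //; rewrite [e]splitr -(subrKA (g y0)).
by apply: le_trans (ler_normD _ _) (lerD gz _); rewrite distrC.
Qed.

(** With [m = 0], the mean of [g] along the segment from [a] to [z]. The weights
    [t ^ m] make the family stable under partial derivatives. *)
Definition radial_mean (m : nat) (g : 'rV[R]_n -> R) (z : 'rV[R]_n) : R :=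
  \int[mu]_(t in `[0, 1]) (t ^+ m * g (a + t *: (z - a))).

Lemma radial_cont m (g : 'rV[R]_n -> R) (z : 'rV[R]_n) (t : R) :
  (forall x, U x -> {for x, continuous g}) -> U z ->
  t \in `[0, 1] -> {for t, continuous (fun s : R => s ^+ m * g (a + s *: (z - a)))}.
Proof.
move=> cg Uz tt; apply: (@continuousM _ _ (fun s : R => s ^+ m)).
  exact: exprn_continuous.
apply: (@continuous_comp _ _ _ (fun s : R => a + s *: (z - a)) g).
  apply: cvgD; first exact: cvg_cst.
  by apply: cvgZr_tmp; exact: cvg_id.
by apply: cg; exact: starU.
Qed.

Lemma expr01_le1 m (t : R) : t \in `[0, 1] -> `|t ^+ m| <= 1.
Proof.
rewrite in_itv /= => /andP[t0 t1]; rewrite ger0_norm ?exprn_ge0 //.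
by rewrite exprn_ile1.
Qed.

Lemma radial_mean_continuous m (g : 'rV[R]_n -> R) (z : 'rV[R]_n) :
  (forall x, U x -> {for x, continuous g}) ->
  U z -> {for z, continuous (radial_mean m g)}.
Proof.
move=> cg Uz; apply/(@cvgrPdist_le _ R^o _ (nbhs z)) => e e0.
have Nz : \forall w \near z, U w by exact: (open_nbhs_nbhs (conj oU Uz)).
apply: (@filterS2 _ (nbhs z) _ _ _ _ _ Nz (seg_near cg Uz e0)) => w Uw H.
rewrite distrC; apply: int01_dist.
- by move=> t; exact: radial_cont.
- by move=> t; exact: radial_cont.
move=> t tt; rewrite -mulrBr normrM; apply: le_trans (_ : 1 * e <= _).
  by apply: ler_pM => //; [exact: expr01_le1 | have [] := H t tt].
by rewrite mul1r.
Qed.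

(** Differentiation under the integral: by the mean value theorem the difference
    quotients of the integrand converge uniformly on [[0, 1]]. *)
Lemma radial_mean_is_derive m (g : 'rV[R]_n -> R) (z : 'rV[R]_n) i : Ck 1 U g -> U z ->
  is_derive z (delta_mx 0 i) (radial_mean m g)
    (radial_mean m.+1 ('D_(delta_mx 0 i) g) z).
Proof.
move=> Cg Uz; have [cg /(_ i)[dg [cdg _]]] := Cg.
set e_ := delta_mx 0 i : 'rV[R]_n.
have ne : `|e_| <= 1.
  apply: row_norm_le => // j; rewrite mxE eqxx /=; case: (j == i); by rewrite ?normr1 ?normr0.
have shiftE (s t : R) : a + t *: (z + s *: e_ - a) = a + t *: (z - a) + (t * s) *: e_.
  by rewrite -[RHS]addrA; congr (_ + _); rewrite -scalerA -scalerDr addrAC.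
suff C : h^-1 *: ((radial_mean m g \o shift z) (h *: e_) - radial_mean m g z : R^o)
    @[h --> (0 : R)^'] --> (radial_mean m.+1 ('D_e_ g) z : R^o).
  by split; [apply/cvg_ex; eexists; exact: C | apply: cvg_lim => //; exact: C].
apply/cvgrPdist_le => e e0.
have /nbhs_ballP[r /= r0 Hr] := seg_near cdg Uz e0.
near=> h; rewrite distrC.
have h0 : h != 0 by near: h; exact: nbhs_dnbhs_neq.
have hr : `|h| < r by near: h; exact: dnbhs0_lt.
have inball (s : R) : `|s| <= `|h| -> ball z r (z + s *: e_).
  move=> sh; rewrite -ball_normE /= opprD addNKr normrN normrZ.
  apply: le_lt_trans hr; apply: le_trans sh; exact: ler_piMr.
have t1 : (1 : R) \in `[0, 1] by rewrite in_itv /= ler01 lexx.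
have Uball (s : R) : `|s| <= `|h| -> U (z + s *: e_).
  by move=> /inball/Hr/(_ 1 t1)[+ _]; rewrite scale1r addrC subrK.
have Uh := Uball h (lexx _).
rewrite [X in `|X - _|](_ : _ = h^-1 * (radial_mean m g (z + h *: e_) - radial_mean m g z)).
  2: by rewrite /= [X in radial_mean m g X]addrC.
rewrite /radial_mean -RintegralB //; first last.
- by apply: cont01_integrable => t; exact: radial_cont.
- by apply: cont01_integrable => t; exact: radial_cont.
have cB t : t \in `[0, 1] -> {for t, continuous (fun t : R =>
    t ^+ m * g (a + t *: (z + h *: e_ - a)) - t ^+ m * g (a + t *: (z - a)))}.
  move=> tt; exact: (@continuousB _ R^o _ _ _ _ (radial_cont cg Uh tt) (radial_cont cg Uz tt)).
have cM t : t \in `[0, 1] -> {for t, continuous (fun t : R =>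
    h^-1 * (t ^+ m * g (a + t *: (z + h *: e_ - a)) - t ^+ m * g (a + t *: (z - a))))}.
  move=> tt; exact: (@continuousM _ _ (fun=> h^-1) _ t (@cst_continuous _ _ _ _) (cB t tt)).
rewrite -RintegralZl //; last exact: cont01_integrable.
apply: int01_dist.
- move=> t tt; exact: cM.
- by move=> t tt; apply: (@radial_cont m.+1 ('D_e_ g) z t) => //; exact: cdg.
move=> t tt; rewrite shiftE -mulrBr.
(* The displacement at parameter [t] is [t * h], hence the extra factor [t]. *)
have [t0|t0] := eqVneq t 0.
  by rewrite t0 mul0r !scale0r !addr0 subrr !mulr0 exprS !mul0r subr0 normr0 ltW.
set y := a + t *: (z - a).
have L : `|g (y + (t * h) *: e_) - g y - (t * h) * 'D_e_ g y| <= e * `|t * h|.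
  apply: line_mvt => s sth.
  have sh : `|t^-1 * s| <= `|h|.
    by rewrite normrM normfV ler_pdivrMl ?normr_gt0 // -normrM.
  have /Hr/(_ t tt) := inball _ sh.
  by rewrite shiftE mulVKf // => -[Us Ds]; split => //; exact: dg.
have -> : h^-1 * (t ^+ m * (g (y + (t * h) *: e_) - g y)) - t ^+ m.+1 * 'D_e_ g y =
   (t ^+ m / h) * (g (y + (t * h) *: e_) - g y - (t * h) * 'D_e_ g y).
  by rewrite exprS; field.
rewrite normrM; apply: le_trans (ler_wpM2l (normr_ge0 _) L) _.
rewrite mulrCA ger_pMr // -normrM.
rewrite [X in `|X|](_ : _ = t ^+ m.+1) ?expr01_le1 //; rewrite exprS; field.
by [].
Unshelve. all: by end_near. Qed.

Lemma Ck_radial_mean k m g : Ck k U g -> Ck k U (radial_mean m g).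
Proof.
elim: k m g => [|k IH] m g Cg.
  by split=> // x; apply: radial_mean_continuous; exact: Cg.1.
split=> [x|i]; first by apply: radial_mean_continuous; exact: Cg.1.
have D x : U x -> is_derive x (delta_mx 0 i) (radial_mean m g)
    (radial_mean m.+1 ('D_(delta_mx 0 i) g) x).
  by apply: radial_mean_is_derive; exact: Ck_le Cg.
split=> [x /D[] //|].
apply: (@Ck_eq _ _ _ _ (radial_mean m.+1 ('D_(delta_mx 0 i) g))) => //.
  by move=> x /D[_ ->].
by apply: IH; have [_ /(_ i)[]] := Cg.
Qed.

Lemma radial_expansion (f : 'rV[R]_n -> R) (z : 'rV[R]_n) : Ck 1 U f -> U z ->
  f z = f a + \sum_j (z 0 j - a 0 j) * radial_mean 0 ('D_(delta_mx 0 j) f) z.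
Proof.
move=> Cf Uz; have [cf df] := Cf.
pose F (t : R) := f (a + t *: (z - a)).
pose dF (t : R) := \sum_j (z 0 j - a 0 j) * (t ^+ 0 * 'D_(delta_mx 0 j) f (a + t *: (z - a))).
have DF (t : R) : t \in `[0, 1] -> is_derive t 1 F (dF t).
  move=> tt; have Uy := starU Uz tt.
  have [dfy e] := C1_is_diff oU Cf Uy.
  have := is_derive_line (@diff_derivable _ _ R^o f _ (z - a) dfy).
  rewrite deriveE // e /grad; congr (is_derive _ _ _ _); apply: eq_bigr => j _.
  by rewrite !mxE expr0 mul1r.
have cdF j t : t \in `[0, 1] -> {for t, continuous (fun t : R => (z 0 j - a 0 j) *
    (t ^+ 0 * 'D_(delta_mx 0 j) f (a + t *: (z - a))))}.
  move=> tt; apply: (@continuousM _ _ (fun=> z 0 j - a 0 j) _ t (@cst_continuous _ _ _ _)).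
  by apply: (@radial_cont 0 ('D_(delta_mx 0 j) f) z t) => //; have [_ []] := df j.
have cF t : t \in `[0, 1] -> {for t, continuous F}.
  by move=> /DF[d _]; apply/differentiable_continuous/derivable1_diffP.
have cdFs t : t \in `[0, 1] -> {for t, continuous dF}.
  by move=> tt; apply: continuous_for_sum => j; exact: cdF.
have i0 : (0 : R) \in `[0, 1] by rewrite in_itv /= ler01 lexx.
have i1 : (1 : R) \in `[0, 1] by rewrite in_itv /= ler01 lexx.
have E : \int[mu]_(t in `[0, 1]) dF t = F 1 - F 0.
  rewrite /Rintegral (@continuous_FTC2 _ dF F) //.
  - by apply: continuous_in_subspaceT => t /[!inE] /= tt; exact: cdFs.
  - split; first by move=> t /subset_itv_oo_cc/DF[].
      by apply: cvg_at_right_filter; exact: cF.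
    by apply: cvg_at_left_filter; exact: cF.
  - by move=> t /subset_itv_oo_cc/DF[d e]; rewrite derive1E.
have -> : f z = F 1 by rewrite /F scale1r addrC subrK.
have -> : f a = F 0 by rewrite /F scale0r addr0.
apply/eqP; rewrite addrC -subr_eq -E int01_sum //; apply/eqP.
apply: eq_bigr => j _; rewrite RintegralZl //.
apply: cont01_integrable => t tt.
by apply: (@radial_cont 0 ('D_(delta_mx 0 j) f) z t) => //; have [_ []] := df j.
Qed.

Lemma radial_mean_center (f : 'rV[R]_n -> R) : radial_mean 0 f a = f a.
Proof.
rewrite /radial_mean; under eq_Rintegral do rewrite expr0 mul1r subrr scaler0 addr0.
by rewrite Rintegral_cst // mu01 mulr1.
Qed.

End Hadamard.

(** [h j] is the mean of the [j]-th partial derivative along the segment from [a]: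
    integrate [t |-> f (a + t (z - a))] over [[0, 1]]. *)
Lemma hadamard {R : realType} {n : nat} (U : set 'rV[R]_n) (a : 'rV[R]_n)
    (f : 'rV[R]_n -> R) : open U -> U a ->
  (forall (z : 'rV[R]_n) (t : R), U z -> t \in `[0, 1] -> U (a + t *: (z - a))) -> Cinfty U f ->
  exists h : 'I_n -> 'rV[R]_n -> R, [/\ forall j, Cinfty U (h j),
    forall z, U z -> f z = f a + \sum_j (z 0 j - a 0 j) * h j z &
    forall j, h j a = 'D_(delta_mx 0 j) f a].
Proof.
move=> oU Ua star Cf; exists (fun j => radial_mean a 0 ('D_(delta_mx 0 j) f)); split.
- by move=> j k; apply: Ck_radial_mean => //; have [_ /(_ j)[]] := Cf k.+1.
- by move=> z Uz; apply: (radial_expansion oU star (Cf 1) Uz).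
- by move=> j; exact: radial_mean_center.
Qed.

(** * Smooth functions on a manifold and bump functions *)

Lemma open_setI_preimage {T T' : topologicalType} (A : set T) (B : set T') (f : T -> T') :
  open A -> open B -> (forall x, A x -> {for x, continuous f}) -> open (A `&` f @^-1` B).
Proof.
move=> oA oB cf; rewrite openE => x [Ax Bfx].
apply: filterI; first exact: (open_nbhs_nbhs (conj oA Ax)).
exact: (cf x Ax _ (open_nbhs_nbhs (conj oB Bfx))).
Qed.

Section SmoothOn.
Context {R : realType} {n : nat} {M : manifold R n}.
Implicit Types (U V : set M) (f g : M -> R) (c d : chart R n M).

Lemma chart_image_open c U : open U -> open (cmap c @` cdom c `&` cinv c @^-1` U).
Proof.
move=> oU; apply: open_setI_preimage => //; first exact: cimg_open.
exact: cinv_continuous.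
Qed.

Lemma chart_preimage_open c (V : set 'rV[R]_n) : open V -> open (cdom c `&` cmap c @^-1` V).
Proof.
by move=> oV; apply: open_setI_preimage (@cdom_open _ _ _ c) oV _; exact: cmap_continuous.
Qed.

Lemma smooth_on_subset U V f : U `<=` V -> smooth_on V f -> smooth_on U f.
Proof.
by move=> UV sf c ac k; apply: Ck_subset (sf c ac k) => y [cy /UV].
Qed.

Lemma smooth_on_setU U V f : smooth_on U f -> smooth_on V f -> smooth_on (U `|` V) f.
Proof.
move=> sU sV c ac k; apply: Ck_subset (Ck_setU (sU c ac k) (sV c ac k)).
by move=> y [cy [Uy|Vy]]; [left|right].
Qed.

Lemma smooth_on_eq U f g : open U -> (forall x, U x -> f x = g x) ->
  smooth_on U f -> smooth_on U g.
Proof.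
move=> oU fg sf c ac k; apply: Ck_eq (sf c ac k); first exact: chart_image_open.
by move=> y [_ /fg].
Qed.

Lemma smooth_on_cst U (a : R) : smooth_on U (cst a).
Proof. by move=> c ac k; exact: Ck_cst. Qed.

Lemma smooth_onD U f g : open U -> smooth_on U f -> smooth_on U g -> smooth_on U (f + g).
Proof. by move=> oU sf sg c ac k; apply: CkD (sf c ac k) (sg c ac k); exact: chart_image_open. Qed.

Lemma smooth_onM U f g : open U -> smooth_on U f -> smooth_on U g -> smooth_on U (f * g).
Proof. by move=> oU sf sg c ac k; apply: CkM (sf c ac k) (sg c ac k); exact: chart_image_open. Qed.

Lemma smooth_on_sum U (I : Type) (r : seq I) (F : I -> M -> R) : open U ->
  (forall i, smooth_on U (F i)) -> smooth_on U (fun x => \sum_(i <- r) F i x).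
Proof. by move=> oU sF c ac k; apply: Ck_sum => [|i]; [exact: chart_image_open|exact: sF]. Qed.

Lemma smoothfunP (f : smoothfun M) U : smooth_on U f.
Proof. by apply: (@smooth_on_subset _ setT) => //; case: f => f /= /asboolP. Qed.

(** Seen in another chart, this is the composition of [g] with a transition map. *)
Lemma smooth_on_chart c (V : set 'rV[R]_n) (g : 'rV[R]_n -> R) : atlas c -> open V ->
  Cinfty V g -> smooth_on (cdom c `&` cmap c @^-1` V) (g \o cmap c).
Proof.
move=> ac oV sg d ad k.
apply: (@Ck_comp _ _ _ _ _ V g (fun y => cmap c (cinv d y))) => //.
- exact/chart_image_open/chart_preimage_open.
- by move=> y [_ []].
move=> j; apply: Ck_subset (atlas_compat ad ac j k).
move=> _ [[p dp <-] [/=]]; rewrite (cmapK dp) => cp _.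
by exists p.
Qed.

Definition smoothfun_of f (sf : smooth_on setT f) : smoothfun M :=
  SmoothFun (introT (asboolP _) sf).

(** [chi] vanishes on a neighbourhood of the complement of [U]. Then products of
    [chi] with functions smooth on [U] are smooth on the whole manifold, whatever
    the values of these functions outside [U]. *)
Definition cutoff_for U (chi : smoothfun M) : Prop :=
  exists W : set M, [/\ open W, W `|` U = setT & forall y, W y -> chi y = 0].

Lemma cutoff_out U chi y : cutoff_for U chi -> ~ U y -> chi y = 0.
Proof.
move=> [W [_ WU W0]] nUy; apply: W0.
by have : (W `|` U) y by [rewrite WU]; case.
Qed.

Lemma cutoff_smooth U chi g : open U -> cutoff_for U chi -> smooth_on U g ->
  smooth_on setT (fun y => chi y * g y).
Proof.
move=> oU [W [oW <- W0]] sg; apply: smooth_on_setU.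
  by apply: (smooth_on_eq oW) (smooth_on_cst W 0) => y /W0 ->; rewrite mul0r.
exact: smooth_onM oU (smoothfunP chi U) sg.
Qed.

Lemma bump_exists U x : open U -> U x ->
  exists chi : smoothfun M, chi x = 1 /\ cutoff_for U chi.
Proof.
move=> oU Ux; have [c ac cx] := atlas_cover x.
pose V := cmap c @` cdom c `&` cinv c @^-1` U.
have oV : open V by exact: chart_image_open.
set a := cmap c x.
have Va : V a by split; [exists x | rewrite /= cmapK].
have /nbhs_ballP[r /= r0 rV] := open_nbhs_nbhs (conj oV Va).
pose s := r / 2; have s0 : 0 < s by rewrite divr_gt0.
(* A closed cube about [a] inside [V]; its compactness makes the support of the
   bump closed in [M], which is Hausdorff. *)
pose K := [set z : 'rV[R]_n | forall i, (`[a 0 i - s, a 0 i + s]%classic : set R) (z ord0 i)].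
have cK : compact K.
  exact: (@rV_compact R n (fun i => `[a 0 i - s, a 0 i + s]%classic)
    (fun i => @segment_compact R _ _)).
have KE z : K z <-> forall i, `|a 0 i - z 0 i| <= s.
  by split=> H i; have := H i; rewrite /= in_itv /= ler_distlC.
have KV : K `<=` V.
  move=> z /KE Kz; apply: rV; rewrite -ball_normE /=.
  apply: (@le_lt_trans _ _ s); last by rewrite /s ltr_pdivrMr // ltr_pMr // ltr1n.
  by apply: row_norm_le (ltW s0) _ => i; rewrite !mxE.
have cinvK : {within K, continuous (cinv c)}.
  by apply: continuous_in_subspaceT => z /[!inE] /KV[? _]; exact: cinv_continuous.
have oW : open (~` (cinv c @` K)).
  apply: closed_openC; apply: compact_closed; first exact: manifold_hausdorff.
  exact: continuous_compact.
pose q (z : 'rV[R]_n) : R := s ^+ 2 - \sum_i (z 0 i - a 0 i) * (z 0 i - a 0 i).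
pose g z := (flat 0 (s ^+ 2))^-1 * flat 0 (q z).
have Cq k : Ck k setT q.
  apply: (@CkB _ _ k setT (cst (s ^+ 2)) _ openT (Ck_cst k setT _)).
  apply: Ck_sum openT _ => i.
  have Ci : Ck k setT (fun z : 'rV[R]_n => z 0 i - a 0 i).
    exact: (@CkB _ _ k setT _ (cst (a 0 i)) openT (Ck_coord k setT i) (Ck_cst k setT _)).
  exact: (CkM openT Ci Ci).
have Cg : Cinfty setT g.
  move=> k; have Cf := Ck_flat 0 openT (Cq k).
  exact: (CkM openT (Ck_cst k setT _) Cf).
have ga : g a = 1.
  rewrite /g /q big1 ?subr0 => [|i _]; last by rewrite subrr mul0r.
  rewrite mulVf // /flat exprn_gt0 // expr0 mul1r.
  by rewrite gt_eqF // expR_gt0.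
have gK z : ~ K z -> g z = 0.
  move=> nKz; suff q0 : q z <= 0 by rewrite /g [flat 0 (q z)]ifF ?mulr0 // ltNge q0.
  rewrite /q subr_le0.
  have [i] : exists i, s < `|a 0 i - z 0 i|.
    apply: contrapT => H; apply: nKz; apply/KE => i; rewrite leNgt; apply/negP => sz.
    by apply: H; exists i.
  move=> sz; rewrite (bigD1 i) //=; apply: ler_wpDr.
    by apply: sumr_ge0 => j _; rewrite -expr2 sqr_ge0.
  rewrite -expr2 -[X in _ <= X]real_normK ?num_real // distrC.
  by rewrite lerXn2r ?nnegrE // ?(ltW s0) // ltW.
pose f (p : M) := if p \in cdom c then g (cmap c p) else 0.
have f0 p : (~` (cinv c @` K)) p -> f p = 0.
  move=> nKp; rewrite /f; case: ifPn => // /[!inE] cp; apply: gK => Kp; apply: nKp.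
  by exists (cmap c p) => //; rewrite cmapK.
have sf : smooth_on setT f.
  have -> : [set: M] = ~` (cinv c @` K) `|` cdom c.
    apply/esym/seteqP; split=> // p _; have [|] := pselect ((cinv c @` K) p); last by left.
    by move=> [z /KV[[y cy <-] _] <-]; right; rewrite cmapK.
  apply: smooth_on_setU.
    by apply: (smooth_on_eq oW) (smooth_on_cst _ 0) => y /f0 ->.
  apply: (smooth_on_eq (@cdom_open _ _ _ c) (f := g \o cmap c)).
    by move=> y cy; rewrite /f ifT // inE.
  apply: smooth_on_subset (smooth_on_chart ac openT Cg).
  by move=> y cy; split.
exists (smoothfun_of sf); split; first by rewrite /= /f ifT ?inE.
exists (~` (cinv c @` K)); split => //.
apply/seteqP; split=> // p _; have [|] := pselect ((cinv c @` K) p); last by left.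
by move=> [z /KV[_ Uz] <-]; right.
Qed.

End SmoothOn.

(** * Local frames of coordinate fields *)

HB.instance Definition _ (R : realType) n (M : manifold R n) (x : M) (v : tangent x) :=
  GRing.isLinear.Build R (smoothfun M) R^o _ (tangent_val v) (tangentP v).1.

Section LocalFrame.
Context {R : realType} {n : nat} {M : manifold R n}.

Lemma smoothfun_sumE (I : Type) (r : seq I) (F : I -> smoothfun M) y :
  (\sum_(i <- r) F i) y = \sum_(i <- r) F i y.
Proof. by elim/big_ind2: _ => // a b c d /= <- <-. Qed.

Lemma tangent1 (x : M) (v : tangent x) : v 1 = 0.
Proof.
have := (tangentP v).2 1 1; rewrite mulr1 /= mulr1 mul1r.
by move/eqP; rewrite -subr_eq subrr => /eqP.
Qed.

Context (c : chart R n M) (ac : atlas c).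

(** Meaningful only on the domain of [c]. *)
Definition coord_partial j (f : M -> R) (p : M) : R :=
  'D_(delta_mx 0 j) (f \o cinv c) (cmap c p).

Lemma coord_smooth j : smooth_on (cdom c) (fun p => cmap c p 0 j).
Proof.
apply: smooth_on_subset (smooth_on_chart (V := setT) (g := fun z => z 0 j) ac openT _).
  by move=> y cy; split.
by move=> k; exact: Ck_coord.
Qed.

Lemma smoothfun_in_chart (f : smoothfun M) : Cinfty (cmap c @` cdom c) (f \o cinv c).
Proof.
move=> k; have := smoothfunP f setT ac k.
by rewrite preimage_setT setIT.
Qed.

Lemma coord_partial_smooth j (f : smoothfun M) : smooth_on (cdom c) (coord_partial j f).
Proof.
have sD : Cinfty (cmap c @` cdom c) ('D_(delta_mx 0 j) (f \o cinv c)).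
  by move=> k; have [_ /(_ j)[]] := smoothfun_in_chart f k.+1.
apply: smooth_on_subset (smooth_on_chart ac (@cimg_open _ _ _ c) sD).
by move=> y cy; split => //; exists y.
Qed.

Lemma coord_partial_derivable j (f : smoothfun M) p : cdom c p ->
  derivable (f \o cinv c) (cmap c p) (delta_mx 0 j).
Proof.
move=> cp; have [_ /(_ j)[+ _]] := smoothfun_in_chart f 1.
by apply; exists p.
Qed.

Context (chi : smoothfun M) (chi_c : cutoff_for (cdom c) chi).

Lemma coord_derivation j p :
  (fun f : smoothfun M => chi p * coord_partial j f p) \in derivation_pred p.
Proof.
apply/asboolP; have [cp|/(cutoff_out chi_c) ->] := pselect (cdom c p); last first.
  by split=> *; rewrite !mul0r ?mulr0 ?addr0 // mul0r.
split=> [a f g|f g]; rewrite /coord_partial.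
all: have df := @coord_partial_derivable j f p cp.
all: have dg := @coord_partial_derivable j g p cp.
  have -> : 'D_(delta_mx 0 j) ((a *: f + g : smoothfun M) \o cinv c) (cmap c p) =
      a * 'D_(delta_mx 0 j) (f \o cinv c) (cmap c p) + 'D_(delta_mx 0 j) (g \o cinv c) (cmap c p).
    rewrite -[RHS]/(a *: _ + _) -(deriveZ a df).
    by rewrite -(deriveD (@derivableZ _ _ _ _ a _ _ df) dg).
  by ring.
have -> : 'D_(delta_mx 0 j) ((f * g : smoothfun M) \o cinv c) (cmap c p) =
    f p * 'D_(delta_mx 0 j) (g \o cinv c) (cmap c p) +
    g p * 'D_(delta_mx 0 j) (f \o cinv c) (cmap c p).
  by have := deriveM df dg; rewrite /= (cmapK cp).
by ring.
Qed.

Definition coord_field_at j p : tangent p := Tangent (coord_derivation j p).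

Lemma coord_field_smooth j : vfield_smooth_on setT (coord_field_at j).
Proof.
move=> f; apply: cutoff_smooth chi_c (coord_partial_smooth j f).
exact: cdom_open.
Qed.

Definition coord_field j : vfield M := VField (@coord_field_smooth j).

Definition cut_coord j : smoothfun M :=
  smoothfun_of (cutoff_smooth (@cdom_open _ _ _ c) chi_c (coord_smooth j)).

(** The coordinates themselves are not global functions, so [v] is applied to their
    products with [chi], and [v chi] corrects for the derivative of [chi]. *)
Lemma coord_expansion y (v : tangent y) (f : smoothfun M) : cdom c y ->
  chi y * v f = \sum_j (v (cut_coord j) - cmap c y 0 j * v chi) * coord_partial j f y.
Proof.
move=> cy; set b := cmap c y.
have Vb : (cmap c @` cdom c) b by exists y.
have oV := @cimg_open _ _ _ c.
have /nbhs_ballP[r /= r0 rV] := open_nbhs_nbhs (conj oV Vb).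
have oB : open (ball b r) by exact: ball_open.
have star (z : 'rV[R]_n) (t : R) : ball b r z -> t \in `[0, 1] -> ball b r (b + t *: (z - b)).
  rewrite -ball_normE /= in_itv /= => zr /andP[t0 t1].
  rewrite opprD addNKr normrN normrZ (ger0_norm t0).
  apply: le_lt_trans zr; rewrite [leRHS]distrC; exact: ler_piMl.
have [h [Ch hE hb]] := hadamard oB (ballxx b r0) star
  (fun k => Ck_subset rV (smoothfun_in_chart f k)).
have oU := chart_preimage_open c oB; set U := _ `&` _ in oU.
have Uy : U y by split => //; exact: ballxx.
have [rho [rhoy rhoU]] := bump_exists oU Uy.
have sh j : smooth_on U (h j \o cmap c) by exact: smooth_on_chart ac oB (Ch j).
pose H j := smoothfun_of (cutoff_smooth oU rhoU (sh j)).
(* Hadamard's expansion of [f] about [y], made global by multiplying it with [rho],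
   which is supported where the expansion holds, and with [chi]. *)
have E : rho * chi * (f - f y *: (1 : smoothfun M)) = \sum_j (cut_coord j - b 0 j *: chi) * H j.
  apply/val_inj/funext => p; rewrite [RHS]smoothfun_sumE.
  have HE j : ((cut_coord j - b 0 j *: chi) * H j) p =
    (chi p * cmap c p 0 j - b 0 j * chi p) * (rho p * h j (cmap c p)) by [].
  rewrite (eq_bigr _ (fun j _ => HE j)) -[LHS]/(rho p * chi p * (f p - f y * 1)) mulr1.
  have [Up|nUp] := pselect (U p); last first.
    rewrite (cutoff_out rhoU nUp) !mul0r; apply/esym/big1 => j _.
    by rewrite mul0r mulr0.
  have [cp Bp] := Up.
  have := hE _ Bp; rewrite /= (cmapK cp) (cmapK cy) => ->.
  rewrite addrAC subrr add0r mulr_sumr; apply: eq_bigr => j _.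
  by ring.
have vE := congr1 v E; rewrite (tangentP v).2 linear_sum in vE.
have vf : v (f - f y *: (1 : smoothfun M)) = v f.
  by rewrite linearB linearZ /= tangent1 mulr0 subr0.
have f0 : (f - f y *: (1 : smoothfun M)) y = 0.
  by rewrite -[LHS]/(f y - f y * 1) mulr1 subrr.
rewrite vf f0 mulr0 add0r -[(rho * chi) y]/(rho y * chi y) rhoy mul1r in vE.
rewrite vE; apply: eq_bigr => j _.
have T0 : (cut_coord j - b 0 j *: chi) y = 0.
  by rewrite -[LHS]/(chi y * b 0 j - b 0 j * chi y) mulrC subrr.
have Hy : H j y = coord_partial j f y by rewrite -[LHS]/(rho y * h j b) rhoy mul1r hb.
rewrite -[LHS]/(tangent_val v ((cut_coord j - b 0 j *: chi) * H j)).
by rewrite (tangentP v).2 T0 mul0r addr0 Hy linearB linearZ.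
Qed.

End LocalFrame.

(** The fields [D j] are coordinate fields cut off by [chi], and the [xi j] are cut-off
    coordinates. The coefficients of the expansion depend on [v] only through its
    values on fixed functions: they are smooth functions if [v] is the value of a
    vector field, and constants if [v] is kept fixed. *)
Lemma local_frame {R : realType} {n : nat} {M : manifold R n} (x : M) :
  exists (psi chi : smoothfun M) (xi : 'I_n -> smoothfun M) (D : 'I_n -> vfield M),
    psi x = 1 /\ forall y (v : tangent y) (f : smoothfun M),
      psi y * v f = \sum_j (chi y * v (xi j) - xi j y * v chi) * D j y f.
Proof.
have [c ac cx] := atlas_cover x.
have [chi [chix chic]] := bump_exists (@cdom_open _ _ _ c) cx.
have E3 y : (chi ^+ 3) y = chi y * chi y * chi y.
  by rewrite !exprS expr0 mulr1 -[LHS]/(chi y * (chi y * chi y)) mulrA.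
(* One factor [chi] is the price of the expansion in cut-off coordinates, one is
   contained in the coordinate fields, one turns coordinates into cut-off ones. *)
exists (chi ^+ 3), chi, (cut_coord ac chic), (coord_field ac chic).
split=> [|y v f]; first by rewrite E3 chix !mul1r.
rewrite E3; have [cy|ncy] := pselect (cdom c y); last first.
  rewrite big1 => [|j _]; last by rewrite /= (cutoff_out chic ncy) !mul0r mulr0.
  by rewrite (cutoff_out chic ncy) !mul0r.
rewrite -mulrA (coord_expansion ac chic) // mulr_sumr; apply: eq_bigr => j _ /=.
by ring.
Qed.

(** * Arguments of alternating forms *)

Section Slots.
Context {R : realType} {V : lmodType R}.
Implicit Types (v w : V).

Lemma update_at k (u : 'I_k -> V) i v : update u i v i = v.
Proof. by rewrite /update eqxx. Qed.

Lemma update_neq k (u : 'I_k -> V) i j v : j != i -> update u i v j = u j.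
Proof. by rewrite /update => /negPf ->. Qed.

Lemma update_same k (u : 'I_k -> V) i v w : update (update u i v) i w = update u i w.
Proof. by apply/funext => j; rewrite /update; case: eqP. Qed.

Lemma update_comm k (u : 'I_k -> V) i j v w : i != j ->
  update (update u i v) j w = update (update u j w) i v.
Proof.
move=> ij; apply/funext => l; rewrite /update.
by have [->|//] := eqVneq l j; rewrite eq_sym (negPf ij).
Qed.

Lemma update_self k (u : 'I_k -> V) i : update u i (u i) = u.
Proof. by apply/funext => j; rewrite /update; case: eqP => [->|]. Qed.

Lemma update_comp (V' : lmodType R) (h : V -> V') k (u : 'I_k -> V) i v :
  (fun l => h (update u i v l)) = update (fun l => h (u l)) i (h v).
Proof. by apply/funext => j; rewrite /update; case: eqP. Qed.

Lemma vcons_comp (V' : lmodType R) (h : V -> V') k (u : 'I_k -> V) v :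
  (fun l => h (vcons v u l)) = vcons (h v) (fun l => h (u l)).
Proof. by apply/funext => j; rewrite /vcons; case: unliftP. Qed.

Lemma vcons0 k (u : 'I_k -> V) v : vcons v u ord0 = v.
Proof. by rewrite /vcons unlift_none. Qed.

Lemma vconsS k (u : 'I_k -> V) v i : vcons v u (lift ord0 i) = u i.
Proof. by rewrite /vcons liftK. Qed.

Lemma vcons_eta k (u : 'I_k.+1 -> V) : u = vcons (u ord0) (fun i => u (lift ord0 i)).
Proof. by apply/funext => j; rewrite /vcons; case: unliftP => [i|] ->. Qed.

Lemma update_vcons0 k (u : 'I_k -> V) v w : update (vcons v u) ord0 w = vcons w u.
Proof.
by apply/funext => j; rewrite /vcons /update; case: unliftP => [i|] ->.
Qed.

Lemma altform_multilinear k (a : altform V k) : multilinear a.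
Proof. by case: a => a /= /asboolP[]. Qed.

Lemma altform_alternating k (a : altform V k) : Defs.alternating a.
Proof. by case: a => a /= /asboolP[]. Qed.

Lemma altformD k (a : altform V k) u i v w :
  a (update u i (v + w)) = a (update u i v) + a (update u i w).
Proof. by have := altform_multilinear a u i 1 v w; rewrite scale1r mul1r. Qed.

Lemma altform0 k (a : altform V k) u i : u i = 0 -> a u = 0.
Proof.
move=> ui; have := altformD a u i 0 0; rewrite addr0 -ui update_self.
by move/eqP; rewrite -subr_eq subrr => /eqP.
Qed.

Lemma altform_swap k (a : altform V k) u i j v w : i != j ->
  a (update (update u i v) j w) = - a (update (update u i w) j v).
Proof.
move=> ij; apply/eqP; rewrite -addr_eq0.
have alt0 (x : V) : a (update (update u i x) j x) = 0.
  apply: (altform_alternating a ij); rewrite update_at update_neq //.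
  by rewrite update_at.
have := alt0 (v + w).
rewrite altformD [in X in X + _]update_comm // [in X in _ + X]update_comm //.
rewrite !altformD -!(update_comm _ _ _ ij) !alt0 add0r addr0 => E.
by rewrite addrC; apply/eqP.
Qed.

End Slots.

(** * Vector fields, and tensoriality of smoothly multilinear maps *)

Section VectorFieldModule.
Context {R : realType} {n : nat} {M : manifold R n}.
Implicit Types (X Y : vfield M) (f g : smoothfun M).

Lemma vfield_ext X Y : (forall x, X x = Y x) -> X = Y.
Proof.
case: X Y => [X sX] [Y sY] /= XY.
have E : X = Y by apply: functional_extensionality_dep.
by case: Y / E sY XY => sY _; congr VField; exact: Prop_irrelevance.
Qed.

Lemma tangentDE x (v w : tangent x) f : (v + w) f = v f + w f.
Proof. by []. Qed.

Lemma tangentZE x (a : R) (v : tangent x) f : (a *: v) f = a * v f.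
Proof. by []. Qed.

Lemma tangentNE x (v : tangent x) f : (- v) f = - v f.
Proof. by []. Qed.

Lemma tangent_ext x (v w : tangent x) : (forall f, v f = w f) -> v = w.
Proof. by move=> vw; apply/val_inj/funext. Qed.

Lemma vsmul_smooth f X : vfield_smooth_on setT (fun x => f x *: X x).
Proof. by move=> g; exact: smooth_onM openT (smoothfunP f setT) (vfieldP X g). Qed.

Definition vsmul f X : vfield M := VField (@vsmul_smooth f X).

Lemma vadd_smooth X Y : vfield_smooth_on setT (fun x => X x + Y x).
Proof. by move=> g; exact: smooth_onD openT (vfieldP X g) (vfieldP Y g). Qed.

Lemma vzero_smooth : vfield_smooth_on setT (fun x : M => 0 : tangent x).
Proof. by move=> g; exact: smooth_on_cst. Qed.

Lemma vopp_smooth X : vfield_smooth_on setT (fun x => - X x).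
Proof.
move=> g; apply: (smooth_on_eq openT _ (smooth_onM openT (smooth_on_cst setT (-1)) (vfieldP X g))).
by move=> x _ /=; rewrite -[LHS]/(-1 * _) mulN1r.
Qed.

Lemma vscale_smooth (a : R) X : vfield_smooth_on setT (fun x => a *: X x).
Proof. by move=> g; exact: (smooth_onM openT (smooth_on_cst setT a) (vfieldP X g)). Qed.

HB.instance Definition _ := gen_eqMixin (vfield M).
HB.instance Definition _ := gen_choiceMixin (vfield M).

Let vadd X Y : vfield M := VField (@vadd_smooth X Y).
Let vzero : vfield M := VField vzero_smooth.
Let vopp X : vfield M := VField (@vopp_smooth X).
Let vscale a X : vfield M := VField (@vscale_smooth a X).

Let vaddA : associative vadd. Proof. by move=> X Y Z; apply: vfield_ext => x; exact: addrA. Qed.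
Let vaddC : commutative vadd. Proof. by move=> X Y; apply: vfield_ext => x; exact: addrC. Qed.
Let vadd0 : left_id vzero vadd. Proof. by move=> X; apply: vfield_ext => x; exact: add0r. Qed.
Let vaddN : left_inverse vzero vopp vadd.
Proof. by move=> X; apply: vfield_ext => x; exact: addNr. Qed.

HB.instance Definition _ := GRing.isZmodule.Build (vfield M) vaddA vaddC vadd0 vaddN.

Let vscaleA a b X : vscale a (vscale b X) = vscale (a * b) X.
Proof. by apply: vfield_ext => x; exact: scalerA. Qed.
Let vscale1 : left_id 1 vscale. Proof. by move=> X; apply: vfield_ext => x; exact: scale1r. Qed.
Let vscaleDr : right_distributive vscale +%R.
Proof. by move=> a X Y; apply: vfield_ext => x; exact: scalerDr. Qed.
Let vscaleDl X : {morph vscale^~ X : a b / a + b}.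
Proof. by move=> a b; apply: vfield_ext => x; exact: scalerDl. Qed.

HB.instance Definition _ :=
  GRing.Zmodule_isLmodule.Build R (vfield M) vscaleA vscale1 vscaleDr vscaleDl.

Lemma vfieldDE X Y x : (X + Y) x = X x + Y x. Proof. by []. Qed.
Lemma vfieldZE a X x : (a *: X) x = a *: X x. Proof. by []. Qed.
Lemma vfieldNE X x : (- X) x = - X x. Proof. by []. Qed.
Lemma vsmulE f X x : vsmul f X x = f x *: X x. Proof. by []. Qed.

Lemma vfield_sumE (I : Type) (r : seq I) (F : I -> vfield M) x :
  (\sum_(i <- r) F i) x = \sum_(i <- r) F i x.
Proof. by elim/big_ind2: _ => // a b c d <- <-. Qed.

Lemma tangent_sumE (I : Type) (r : seq I) x (F : I -> tangent x) f :
  (\sum_(i <- r) F i) f = \sum_(i <- r) F i f.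
Proof. by elim/big_ind2: _ => // a b c d <- <-. Qed.

Lemma vapp_smulD f X Y g : vapp (vsmul f X + Y) g = f * vapp X g + vapp Y g.
Proof. by apply/val_inj/funext. Qed.

Lemma lie_bracketC X Y : lie_bracket X Y = - lie_bracket Y X.
Proof.
apply: vfield_ext => x; apply: tangent_ext => f.
by rewrite vfieldNE tangentNE /= opprB.
Qed.

Lemma lie_bracket_smulr X f Y Z : lie_bracket X (vsmul f Y + Z) =
  vsmul f (lie_bracket X Y) + vsmul (vapp X f) Y + lie_bracket X Z.
Proof.
apply: vfield_ext => x; apply: tangent_ext => g.
rewrite !vfieldDE !tangentDE !vsmulE !tangentZE /= vapp_smulD tangentD (tangentP _).2.
set t := (T in _ - T = _); have -> : t = f x * Y x (vapp X g) + Z x (vapp X g) by [].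
by rewrite /=; ring.
Qed.

(** Take the expansion of [v] in [local_frame] and keep its coefficients constant. *)
Lemma vfield_through x (v : tangent x) : exists X : vfield M, X x = v.
Proof.
have [psi [chi [xi [D [psix E]]]]] := local_frame x.
exists (\sum_j (chi x * v (xi j) - xi j x * v chi) *: D j).
apply: tangent_ext => f; rewrite vfield_sumE tangent_sumE.
by rewrite -[RHS]mul1r -psix E; apply: eq_bigr => j _; rewrite vfieldZE tangentZE.
Qed.

End VectorFieldModule.

Section Tensoriality.
Context {R : realType} {n : nat} {M : manifold R n}.
Context (k : nat) (F : ('I_k -> vfield M) -> M -> R) (x : M).

Definition smooth_multilinear : Prop :=
  forall (X : 'I_k -> vfield M) i (f : smoothfun M) (Y Z : vfield M),
  F (update X i (vsmul f Y + Z)) x = f x * F (update X i Y) x + F (update X i Z) x.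

Context (Fl : smooth_multilinear).

Lemma smooth_multilinear0 (X : 'I_k -> vfield M) i : F (update X i 0) x = 0.
Proof.
have := Fl X i 1 0 0; rewrite mul1r.
have -> : vsmul 1 0 + 0 = 0 :> vfield M by rewrite addr0; apply: vfield_ext => y; exact: scaler0.
by move/eqP; rewrite -subr_eq subrr => /eqP.
Qed.

Lemma smooth_multilinear_sum (X : 'I_k -> vfield M) i (I : Type) (r : seq I)
    (g : I -> smoothfun M) (D : I -> vfield M) :
  F (update X i (\sum_(j <- r) vsmul (g j) (D j))) x =
  \sum_(j <- r) g j x * F (update X i (D j)) x.
Proof.
elim: r => [|j r IH]; first by rewrite !big_nil smooth_multilinear0.
by rewrite !big_cons Fl IH.
Qed.

(** By [local_frame], [psi Y] is a combination of the fields [D j] whose coefficients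
    at [x] depend only on [Y x], and [psi x = 1]. *)
Lemma smooth_multilinear_slot (X : 'I_k -> vfield M) i (Y Z : vfield M) : Y x = Z x ->
  F (update X i Y) x = F (update X i Z) x.
Proof.
have [psi [chi [xi [D [psix E]]]]] := local_frame x.
have expand Y' : F (update X i Y') x =
    \sum_j (chi x * Y' x (xi j) - xi j x * Y' x chi) * F (update X i (D j)) x.
  rewrite -[LHS]mul1r -psix -[LHS]addr0 -[X in _ + X](smooth_multilinear0 X i) -Fl addr0.
  have -> : vsmul psi Y' = \sum_j vsmul (chi * vapp Y' (xi j) - xi j * vapp Y' chi) (D j).
    apply: vfield_ext => y; apply: tangent_ext => f.
    by rewrite vsmulE tangentZE E vfield_sumE tangent_sumE.
  by rewrite smooth_multilinear_sum.
by move=> YZ; rewrite !expand YZ.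
Qed.

Lemma smooth_multilinear_pointwise (X X' : 'I_k -> vfield M) :
  (forall i, X i x = X' i x) -> F X x = F X' x.
Proof.
move=> XX'.
(* Replace the fields [X i] by [X' i] one slot at a time. *)
pose hyb m (i : 'I_k) := if (i < m)%N then X' i else X i.
have H m : (m <= k)%N -> F X x = F (hyb m) x.
  elim: m => [_|m IH mk]; first by congr F.
  rewrite IH 1?ltnW // -(update_self (hyb m) (Ordinal mk)).
  rewrite (@smooth_multilinear_slot _ _ _ (X' (Ordinal mk))) //; last by rewrite /hyb /= ltnn.
  congr (F _ _); apply/funext => i; rewrite /update /hyb ltnS.
  have [->|im] := eqVneq i (Ordinal mk); first by rewrite leqnn.
  by rewrite [(i <= m)%N]leq_eqVlt -[i == m :> nat]/(i == Ordinal mk) (negPf im).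
rewrite (H k (leqnn k)); congr (F _ _); apply/funext => i.
by rewrite /hyb ltn_ord.
Qed.

Context (Fa : forall (X : 'I_k -> vfield M) i j, i != j -> X i = X j -> F X x = 0).

(** The form is evaluated on tangent vectors by extending them to vector fields; the
    choice of extensions is irrelevant by [smooth_multilinear_pointwise]. *)
Lemma form_ofE (X : 'I_k -> vfield M) : form_of F x (fun i => X i x) = F X x.
Proof.
pose ext (v : tangent x) : vfield M := sval (cid (vfield_through v)).
have extE (v : tangent x) : ext v x = v by rewrite /ext; case: cid.
have altF : (fun u : 'I_k -> tangent x => F (fun i => ext (u i)) x)
    \in @altform_pred R (tangent x) k.
  apply/asboolP; split=> [u i c v w|u i j ij uij] /=; last first.
    by apply: (Fa ij); rewrite uij.
  have P z : F (fun j => ext (update u i z j)) x = F (update (fun j => ext (u j)) i (ext z)) x.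
    by rewrite update_comp.
  rewrite !P; have c1 : (c *: (1 : smoothfun M)) x = c by exact: mulr1.
  have -> : F (update (fun j => ext (u j)) i (ext (c *: v + w))) x =
      F (update (fun j => ext (u j)) i (vsmul (c *: (1 : smoothfun M)) (ext v) + ext w)) x.
    by apply: smooth_multilinear_slot; rewrite vfieldDE vsmulE !extE c1.
  by rewrite Fl c1.
have : [set a : altform (tangent x) k |
    forall Y : 'I_k -> vfield M, a (fun i => Y i x) = F Y x] (form_of F x).
  apply: xgetPex; exists (AltForm altF) => Y /=.
  by apply: smooth_multilinear_pointwise => i; rewrite extE.
by apply.
Qed.

End Tensoriality.

(** * The Lie derivative of a form, and linearity of the invariant formulas *)

Local Notation ev X x := (fun i => X i x).

Section LieExterior.
Context {R : realType} {n : nat} {M : manifold R n}.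
Implicit Types (A B : vfield M) (f g : smoothfun M) (x : M).

Lemma ev_update k (Y : 'I_k -> vfield M) i A x :
  ev (update Y i A) x = update (ev Y x) i (A x).
Proof. exact: (update_comp (fun Z : vfield M => Z x)). Qed.

Lemma ev_vcons k (Y : 'I_k -> vfield M) A x : ev (vcons A Y) x = vcons (A x) (ev Y x).
Proof. exact: (vcons_comp (fun Z : vfield M => Z x)). Qed.

Lemma feval_update k (w : diff_form M k) Y i f A B :
  feval w (update Y i (vsmul f A + B)) = f * feval w (update Y i A) + feval w (update Y i B).
Proof.
apply/val_inj/funext => x.
rewrite -[RHS]/(f x * w x (ev (update Y i A) x) + w x (ev (update Y i B) x)).
rewrite -[LHS]/(w x (ev (update Y i (vsmul f A + B)) x)) !ev_update.
exact: (altform_multilinear (w x) (ev Y x) i (f x) (A x) (B x)).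
Qed.

(** Isolates all occurrences of the field in slot [i]. *)
Lemma lie_formula_update k A (w : diff_form M k) (Y : 'I_k -> vfield M) i Z x :
  lie_formula A w (update Y i Z) x =
  A x (feval w (update Y i Z)) - w x (update (ev Y x) i (lie_bracket A Z x))
  - \sum_(j < k | j != i) w x (update (update (ev Y x) j (lie_bracket A (Y j) x)) i (Z x)).
Proof.
rewrite /lie_formula (bigD1 i) //= opprD addrA; congr (_ - _ - _).
  congr (w x _); apply/funext => l; rewrite -[LHS]/(update (ev (update Y i Z) x) i _ l).
  by rewrite ev_update update_same update_at.
apply: eq_bigr => j ji; congr (w x _).
apply/funext => l; rewrite -[LHS]/(update (ev (update Y i Z) x) j _ l).
by rewrite ev_update (update_neq Y Z ji) update_comm // eq_sym.
Qed.

(** The derivative of the coefficient [f] appears in the derivative of the product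
    [f * w (.., Y, ..)] and in the bracket of [A] with [f Y], with opposite signs. *)
Lemma lie_formula_multilinear k A (w : diff_form M k) x :
  smooth_multilinear (lie_formula A w) x.
Proof.
move=> X i f Y Z; rewrite !lie_formula_update feval_update lie_bracket_smulr.
rewrite tangentD (tangentP _).2 !vfieldDE !vsmulE -addrA !altformD.
have wZ a v : w x (update (ev X x) i (a *: v)) = a * w x (update (ev X x) i v).
  have := altform_multilinear (w x) (ev X x) i a v 0.
  by rewrite addr0 [X in _ + X](@altform0 _ _ _ _ _ i) ?addr0 // update_at.
rewrite !wZ.
pose others v := \sum_(j < k | j != i)
  w x (update (update (ev X x) j (lie_bracket A (X j) x)) i v).
rewrite -/(others (f x *: Y x + Z x)) -/(others (Y x)) -/(others (Z x)).
have -> : others (f x *: Y x + Z x) = f x * others (Y x) + others (Z x).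
  rewrite /others mulr_sumr -big_split /=; apply: eq_bigr => j _; exact: altform_multilinear.
by rewrite /others /= ev_update; ring.
Qed.

(** Two terms of the sum remain; they differ by the exchange of two arguments. *)
Lemma lie_formula_alternating k A (w : diff_form M k) (X : 'I_k -> vfield M) i j x :
  i != j -> X i = X j -> lie_formula A w X x = 0.
Proof.
move=> ij Xij; rewrite /lie_formula.
have -> : feval w X = 0.
  by apply/val_inj/funext => y /=; apply: (altform_alternating (w y) ij); rewrite Xij.
rewrite linear0 sub0r (bigD1 i) // (bigD1 j) 1?eq_sym //=.
rewrite big1 ?addr0 => [|l /andP[li lj]]; last first.
  by apply: (altform_alternating (w x) ij); rewrite !(eq_sym _ l) (negPf li) (negPf lj) Xij.
apply/eqP; rewrite oppr_eq0 addr_eq0; apply/eqP.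
set b := lie_bracket A (X i) x.
have := altform_swap (w x) (ev X x) b (X i x) ij.
have -> : update (update (ev X x) i b) j (X i x) = update (ev X x) i b.
  by rewrite update_comm // Xij update_self.
have -> : update (update (ev X x) i (X i x)) j b = update (ev X x) j b.
  by rewrite update_self.
by rewrite /b {2}Xij.
Qed.

Lemma contr_form_smooth k A (w : diff_form M k.+1) :
  form_smooth_on setT (fun x => contr (A x) (w x)).
Proof.
move=> Y; have := formP w (vcons A Y).
by congr smooth_on; apply/funext => x; rewrite /= -ev_vcons.
Qed.

Definition contr_form k A (w : diff_form M k.+1) : diff_form M k := Form (contr_form_smooth A w).

Lemma contr_formE k A (w : diff_form M k.+1) x u : contr_form A w x u = w x (vcons (A x) u).
Proof. by []. Qed.

Lemma feval_contr k A (w : diff_form M k.+1) Y : feval (contr_form A w) Y = feval w (vcons A Y).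
Proof. by apply/val_inj/funext => x; rewrite /= ev_vcons. Qed.

(** The identity [i_B L_A = L_A i_B - i_[A,B]]. *)
Lemma lie_formula_vcons k A B (w : diff_form M k.+1) (Y : 'I_k -> vfield M) x :
  lie_formula A w (vcons B Y) x =
  lie_formula A (contr_form B w) Y x - w x (vcons (lie_bracket A B x) (ev Y x)).
Proof.
rewrite /lie_formula feval_contr big_ord_recl opprD [- _ - _]addrC addrA; congr (_ - _ - _).
  apply: eq_bigr => j _; rewrite contr_formE; congr (w x _).
  by apply/funext => l; rewrite vconsS /vcons; case: unliftP => [l'|] ->.
congr (w x _); apply/funext => l; rewrite vcons0 /vcons.
by case: unliftP => [l'|] ->.
Qed.

Lemma exterior_formula_lin k (w w1 w2 : diff_form M k) a X x :
  (forall y, w y = a *: w1 y + w2 y) ->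
  exterior_formula w X x = a * exterior_formula w1 X x + exterior_formula w2 X x.
Proof.
move=> E; rewrite /exterior_formula mulr_sumr -big_split; apply: eq_bigr => i _ /=.
have wE y u : w y u = a * w1 y u + w2 y u by rewrite E.
have -> : feval w (fun l => X (lift i l)) =
   a *: feval w1 (fun l => X (lift i l)) + feval w2 (fun l => X (lift i l)).
  by apply/val_inj/funext => y /=; rewrite wE.
rewrite (tangentP _).1; under eq_bigr do rewrite wE.
rewrite big_split -mulr_sumr /=; ring.
Qed.

Lemma exterior_formula0 k (w : diff_form M k) X x :
  (forall y, w y = 0) -> exterior_formula w X x = 0.
Proof.
move=> w0; have := @exterior_formula_lin _ w w w 1 X x; rewrite mul1r => H.
have /eqP : exterior_formula w X x = exterior_formula w X x + exterior_formula w X x.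
  by apply: H => y; rewrite w0 scaler0 addr0.
by rewrite -subr_eq subrr => /eqP.
Qed.

Lemma exterior_formulaN k (w w' : diff_form M k) X x :
  (forall y, w y = - w' y) -> exterior_formula w X x = - exterior_formula w' X x.
Proof.
move=> E; have := @exterior_formula_lin _ w w w' 2 X x.
(* Linearity applied to [w = 2 w + w'] gives [c = 2 c + c'] for the values [c] and [c']
   of the formula on [w] and [w']. *)
have E' y : w y = 2 *: w y + w' y.
  by rewrite scaler_nat mulr2n -addrA [X in _ + (X + _)]E addNr addr0.
by move=> /(_ E'); lra.
Qed.

End LieExterior.

(** * The exterior derivative of a form *)

Section ExteriorTensor.
Context {R : realType} {n : nat} {M : manifold R n}.
Implicit Types (A B : vfield M) (f g : smoothfun M) (x : M).

Lemma exterior_formula_head k (w : diff_form M k) (X : 'I_k.+1 -> vfield M) x :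
  (-1) ^+ (@ord0 k) * (X ord0 x (feval w (fun l => X (lift ord0 l)))
     - \sum_(j < k.+1 | (@ord0 k < j)%N)
         w x (fun l => if lift ord0 l == j then lie_bracket (X ord0) (X j) x
                       else X (lift ord0 l) x)) =
  lie_formula (X ord0) w (fun l => X (lift ord0 l)) x.
Proof.
rewrite expr0 mul1r; congr (_ - _).
rewrite big_mkcond big_ord_recl /= add0r; apply: eq_bigr => j _.
by congr (w x _); apply/funext => l; rewrite (inj_eq lift_inj).
Qed.

Lemma exterior_formula_deg0 (w : diff_form M 0) (X : 'I_1 -> vfield M) x :
  exterior_formula w X x = X ord0 x (feval w (fun l => X (lift ord0 l))).
Proof.
rewrite /exterior_formula big_ord_recl exterior_formula_head big_ord0 addr0.
by rewrite /lie_formula big_ord0 subr0.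
Qed.

(** Cartan's formula [i_A (d w) = L_A w - d (i_A w)]: the terms of index [0] form the
    Lie derivative, and in the others [X ord0] is a fixed first argument. *)
Lemma exterior_formula_rec k (w : diff_form M k.+1) (X : 'I_k.+2 -> vfield M) x :
  exterior_formula w X x = lie_formula (X ord0) w (fun l => X (lift ord0 l)) x
    - exterior_formula (contr_form (X ord0) w) (fun l => X (lift ord0 l)) x.
Proof.
rewrite /exterior_formula big_ord_recl exterior_formula_head; congr (_ + _).
rewrite -sumrN; apply: eq_bigr => i _.
have lift_vcons (i' : 'I_k.+1) : (fun l => X (lift (lift ord0 i') l)) =
    vcons (X ord0) (fun l => X (lift ord0 (lift i' l))).
  apply/funext => l; rewrite /vcons; case: unliftP => [l'|] -> /=.
    by congr X; apply/val_inj; rewrite /= /bump !leq0n !add1n ltnS addnS.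
  by congr X; apply/val_inj.
rewrite lift_vcons feval_contr -mulNr; congr (_ * (_ - _)).
  by rewrite exprS mulN1r.
rewrite big_mkcond big_ord_recl /= add0r [in RHS]big_mkcond; apply: eq_bigr => j _.
rewrite /= /bump /= !add1n ltnS; case: ifP => // _; congr (w x _); apply/funext => l.
have := congr1 (fun u : 'I_k.+1 -> vfield M => u l x) (lift_vcons i) => /= ->.
rewrite /vcons; case: unliftP => [l'|] -> /=.
  have -> : (lift (lift ord0 i) (lift ord0 l') == lift ord0 j) = (lift i l' == j).
    rewrite -[RHS](inj_eq (@lift_inj _ ord0)); congr (_ == _).
    by apply/val_inj; rewrite /= /bump !leq0n !add1n ltnS addnS.
  by case: ifP.
by [].
Qed.

Lemma exterior_formula_vcons0 A B (w : diff_form M 1) (X : 'I_0 -> vfield M) x :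
  exterior_formula w (vcons A (vcons B X)) x =
  lie_formula A (contr_form B w) X x - lie_formula B (contr_form A w) X x
  - w x (vcons (lie_bracket A B x) (ev X x)).
Proof.
rewrite exterior_formula_rec vcons0.
under [X in lie_formula _ _ X]funext do rewrite vconsS.
under [X in exterior_formula _ X]funext do rewrite vconsS.
rewrite lie_formula_vcons exterior_formula_deg0 vcons0.
under [X in feval _ X]funext do rewrite vconsS.
by rewrite [lie_formula B _ _ _]/lie_formula big_ord0 subr0 addrAC.
Qed.

(** Two uses of Cartan's formula. The right-hand side is visibly antisymmetric in
    [A] and [B], which is how the exterior derivative is shown to be alternating. *)
Lemma exterior_formula_vconsS k A B (w : diff_form M k.+2) (X : 'I_k.+1 -> vfield M) x :
  exterior_formula w (vcons A (vcons B X)) x =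
  lie_formula A (contr_form B w) X x - lie_formula B (contr_form A w) X x
  - w x (vcons (lie_bracket A B x) (ev X x))
  + exterior_formula (contr_form B (contr_form A w)) X x.
Proof.
rewrite exterior_formula_rec vcons0.
under [X in lie_formula _ _ X]funext do rewrite vconsS.
under [X in exterior_formula _ X]funext do rewrite vconsS.
rewrite lie_formula_vcons exterior_formula_rec vcons0.
under [X in lie_formula B _ X]funext do rewrite vconsS.
under [X in exterior_formula (contr_form B _) X]funext do rewrite vconsS.
by ring.
Qed.

Lemma altform_vcons_swap k (x : M) (a : altform (tangent x) k.+2) v w u :
  a (vcons v (vcons w u)) = - a (vcons w (vcons v u)).
Proof.
have E v' w' : vcons v' (vcons w' u) =
    update (update (vcons 0 (vcons 0 u)) ord0 v') (lift ord0 ord0) w'.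
  by rewrite update_vcons0 -update_vcons update_vcons0.
by rewrite (E v w) (E w v) altform_swap.
Qed.

Lemma exterior_formula_swap k A B (w : diff_form M k.+1) (X : 'I_k -> vfield M) x :
  exterior_formula w (vcons A (vcons B X)) x = - exterior_formula w (vcons B (vcons A X)) x.
Proof.
have wN v : w x (vcons (- v) (ev X x)) = - w x (vcons v (ev X x)).
  have := altform_multilinear (w x) (vcons 0 (ev X x)) ord0 (-1) v 0.
  rewrite addr0 scaleN1r mulN1r [X in _ + X](@altform0 _ _ _ _ _ ord0) ?update_at // addr0.
  by rewrite !update_vcons0.
have LN : w x (vcons (lie_bracket A B x) (ev X x)) = - w x (vcons (lie_bracket B A x) (ev X x)).
  by rewrite -wN lie_bracketC.
(* A form of degree 1 cannot be contracted twice. *)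
case: k w X wN LN => [|k] w X wN LN.
  by rewrite !exterior_formula_vcons0 LN; ring.
rewrite !exterior_formula_vconsS LN.
rewrite (@exterior_formulaN _ _ _ _ (contr_form B (contr_form A w))
  (contr_form A (contr_form B w))).
  by ring.
by move=> y; apply/val_inj/funext => u /=; exact: altform_vcons_swap.
Qed.

Lemma update_lift k (X : 'I_k.+1 -> vfield M) i A :
  (fun l => update X (lift ord0 i) A (lift ord0 l)) = update (fun l => X (lift ord0 l)) i A.
Proof. by apply/funext => l; rewrite /update (inj_eq lift_inj). Qed.

(** By induction on the degree, using Cartan's formula for all slots but the first;
    the first slot is exchanged with the second. *)
Lemma exterior_formula_multilinear k (w : diff_form M k) x :
  smooth_multilinear (exterior_formula w) x.
Proof.
elim: k w => [|k IH] w X i f Y Z.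
  rewrite !exterior_formula_deg0 (ord1 i) !update_at vfieldDE vsmulE.
  have E A : (fun l => update X ord0 A (lift ord0 l)) = (fun l => X (lift ord0 l)).
    by apply/funext => -[].
  by rewrite !E.
have slotS (X' : 'I_k.+2 -> vfield M) (i' : 'I_k.+1) :
    exterior_formula w (update X' (lift ord0 i') (vsmul f Y + Z)) x =
    f x * exterior_formula w (update X' (lift ord0 i') Y) x +
    exterior_formula w (update X' (lift ord0 i') Z) x.
  by rewrite !exterior_formula_rec !update_lift !update_neq // IH lie_formula_multilinear; ring.
case: (unliftP ord0 i) => [i'|] ->; first exact: slotS.
have E A : update X ord0 A =
    vcons A (vcons (X (lift ord0 ord0)) (fun l => X (lift ord0 (lift ord0 l)))).
  by rewrite {1}(vcons_eta X) update_vcons0 {1}(vcons_eta (fun l => X (lift ord0 l))).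
have E' A : vcons (X (lift ord0 ord0)) (vcons A (fun l => X (lift ord0 (lift ord0 l)))) =
    update (vcons (X (lift ord0 ord0)) (vcons 0 (fun l => X (lift ord0 (lift ord0 l)))))
      (lift ord0 ord0) A.
  by rewrite -update_vcons update_vcons0.
have headE A := etrans (congr1 (fun X' => exterior_formula w X' x) (E A))
  (etrans (exterior_formula_swap A _ w _ x) (congr1 (fun X' => - exterior_formula w X' x) (E' A))).
by rewrite /= in headE; rewrite !headE slotS; ring.
Qed.

(** Equal arguments outside the first slot are covered by Cartan's formula and
    induction. An argument equal to the first is either the second, where
    antisymmetry applies, or is moved out of the first slot by an exchange. *)
Lemma exterior_formula_alternating k (w : diff_form M k) (X : 'I_k.+1 -> vfield M) i j x :
  i != j -> X i = X j -> exterior_formula w X x = 0.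
Proof.
elim: k w X i j => [|k IH] w X i j; first by rewrite !ord1 eqxx.
have lifted (X' : 'I_k.+2 -> vfield M) i' j' : i' != j' ->
    X' (lift ord0 i') = X' (lift ord0 j') -> exterior_formula w X' x = 0.
  move=> ij Xij; rewrite exterior_formula_rec.
  by rewrite (lie_formula_alternating _ _ _ ij Xij) (IH _ _ _ _ ij Xij) subrr.
have headed j' : X ord0 = X (lift ord0 j') -> exterior_formula w X x = 0.
  move=> Xj; rewrite (vcons_eta X) (vcons_eta (fun l => X (lift ord0 l))).
  case: (unliftP ord0 j') Xj => [j''|] -> Xj; last first.
    have := exterior_formula_swap (X ord0) (X ord0) w (fun l => X (lift ord0 (lift ord0 l))) x.
    by rewrite -Xj; lra.
  rewrite exterior_formula_swap (@lifted _ ord0 (lift ord0 j'')) ?oppr0 //.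
  by rewrite !vconsS vcons0.
case: (unliftP ord0 i) => [i'|] ->; case: (unliftP ord0 j) => [j'|] -> //.
- by rewrite (inj_eq lift_inj); exact: lifted.
- by move=> _ /esym; exact: headed.
- by move=> _; exact: headed.
Qed.

Lemma ext_derivE k (w : diff_form M k) (X : 'I_k.+1 -> vfield M) x :
  ext_deriv w x (ev X x) = exterior_formula w X x.
Proof.
apply: form_ofE; first exact: exterior_formula_multilinear.
by move=> Y i j; exact: exterior_formula_alternating.
Qed.

Lemma lie_derivativeE k A (w : diff_form M k) (X : 'I_k -> vfield M) x :
  lie_derivative A w x (ev X x) = lie_formula A w X x.
Proof.
apply: form_ofE; first exact: lie_formula_multilinear.
by move=> Y i j; exact: lie_formula_alternating.
Qed.

End ExteriorTensor.

(** * Involutivity of L *)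

Section Dorfman.
Context {R : realType} {n : nat} {M : manifold R n}.
Implicit Types (A B C : vfield M) (x y : M).

(** The determinants defining [a] have a zero column. *)
Lemma wedge_ann_contr (V : lmodType R) k (S : set V) (a : altform V k.+1) v :
  wedge_ann S a -> S v -> contr v a = 0.
Proof.
move=> [N [c [b [bS aE]]]] Sv; apply/val_inj/funext => u /=.
rewrite aE big1 // => l _; rewrite (expand_det_col _ ord0) big1 ?mulr0 // => i _.
by rewrite mxE vcons0 bS // mul0r.
Qed.

Lemma wedge_ann0 (V : lmodType R) k (S : set V) : wedge_ann S (0 : altform V k).
Proof.
have b : 'I_0 -> 'I_k -> {scalar V} by case.
exists 0%N, (fun=> 0), b; split; first by case.
by move=> u; rewrite big_ord0.
Qed.

(** Multiply a combination with constant coefficients of a local frame of [L] by a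
    bump function. *)
Lemma pr_tangent_section p (L : forall x : M, set (Ebundle M p x)) x (v : tangent x) :
  smooth_subbundle L -> pr_tangent L x v ->
  exists Z : vfield M, Z x = v /\ forall y, pr_tangent L y (Z y).
Proof.
move=> Lsub [e Le <-]; have [U [r [b [oU Ux sb basis]]]] := Lsub x.
have [chi [chix chiU]] := bump_exists oU Ux.
have [Lx _] := basis x Ux; move: Le; rewrite Lx => -[c _ <-].
have sZ : vfield_smooth_on setT (fun y => chi y *: (\sum_(i < r) c i *: (b i y).1)).
  move=> f.
  have sg : smooth_on U (fun y => \sum_(i < r) (cst (c i) * (fun y => (b i y).1 f)) y).
    apply: smooth_on_sum => // i; apply: smooth_onM oU (smooth_on_cst U (c i)) _.
    by have [] := sb i.
  have := cutoff_smooth oU chiU sg.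
  by congr smooth_on; apply/funext => y; rewrite tangentZE tangent_sumE.
have fst_sum y (d : 'I_r -> R) :
    (\sum_(i < r) d i *: b i y : Ebundle M p y).1 = \sum_(i < r) d i *: (b i y).1.
  by elim/big_ind2: _ => // u1 u2 v1 v2 <- <-.
exists (VField sZ); split=> [|y] /=; first by rewrite chix scale1r fst_sum.
have [Uy|nUy] := pselect (U y); last first.
  rewrite (cutoff_out chiU nUy) scale0r.
  have [U' [r' [b' [_ Uy' _ basis']]]] := Lsub y; have [Ly _] := basis' y Uy'.
  by exists 0 => //; rewrite Ly; exists (fun=> 0) => //; rewrite big1 // => i _; rewrite scale0r.
have [Ly _] := basis y Uy.
exists (\sum_(i < r) (chi y * c i) *: b i y); first by rewrite Ly; eexists.
by rewrite fst_sum scaler_sumr; apply: eq_bigr => i _; rewrite scalerA.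
Qed.

Lemma form_sub_smooth k (w w' : diff_form M k) : form_smooth_on setT (fun x => w x - w' x).
Proof.
move=> X; have sN := smooth_onM openT (smooth_on_cst setT (-1)) (formP w' X).
have := smooth_onD openT (formP w X) sN.
by congr smooth_on; apply/funext => x; rewrite -[LHS]/(_ + (-1) * _) mulN1r.
Qed.

Definition form_sub k (w w' : diff_form M k) : diff_form M k := Form (form_sub_smooth w w').

Lemma lie_formula_lin k A (w w1 w2 : diff_form M k) a X x :
  (forall y, w y = a *: w1 y + w2 y) ->
  lie_formula A w X x = a * lie_formula A w1 X x + lie_formula A w2 X x.
Proof.
move=> E; have wE y u : w y u = a * w1 y u + w2 y u by rewrite E.
rewrite /lie_formula; have -> : feval w X = a *: feval w1 X + feval w2 X.
  by apply/val_inj/funext => y /=; rewrite wE.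
rewrite (tangentP _).1; under eq_bigr do rewrite wE.
by rewrite big_split -mulr_sumr /=; ring.
Qed.

Lemma lie_formula0 k A (w : diff_form M k) X x :
  (forall y, w y = 0) -> lie_formula A w X x = 0.
Proof.
move=> w0; have H := @lie_formula_lin _ A w w w 1 X x.
have {}H : lie_formula A w X x = 1 * lie_formula A w X x + lie_formula A w X x.
  by apply: H => y; rewrite w0 scaler0 addr0.
by move: H; lra.
Qed.

Lemma exterior_formula_cartan k A (w : diff_form M k.+1) (X : 'I_k.+1 -> vfield M) x :
  exterior_formula w (vcons A X) x = lie_formula A w X x - exterior_formula (contr_form A w) X x.
Proof.
rewrite exterior_formula_rec vcons0.
by under [X in lie_formula _ _ X]funext do rewrite vconsS;
  under [X in exterior_formula _ X]funext do rewrite vconsS.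
Qed.

(** The part of the Dorfman bracket that obstructs involutivity, contracted with [C]:
    with [alpha = eta - i_A omega] and [beta = theta - i_B omega], it is
    [L_A beta - i_B d alpha + i_B i_A d omega]. *)
Lemma dorfman_defect p (omega : diff_form M p.+2) (eta theta : diff_form M p.+1) A B C
    (V : 'I_p -> vfield M) x :
  (lie_derivative A theta x - contr (B x) (ext_deriv eta x)
     - contr (lie_bracket A B x) (omega x)) (vcons (C x) (ev V x)) =
  lie_formula A (form_sub theta (contr_form B omega)) (vcons C V) x
  - exterior_formula (form_sub eta (contr_form A omega)) (vcons B (vcons C V)) x
  + exterior_formula omega (vcons A (vcons B (vcons C V))) x.
Proof.
rewrite -[LHS]/(lie_derivative A theta x (vcons (C x) (ev V x))
   - ext_deriv eta x (vcons (B x) (vcons (C x) (ev V x)))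
   - omega x (vcons (lie_bracket A B x) (vcons (C x) (ev V x)))).
rewrite -!ev_vcons lie_derivativeE ext_derivE.
rewrite (@exterior_formula_lin _ _ _ _ eta (contr_form A omega)
  (form_sub eta (contr_form A omega)) 1).
  2: by move=> y; rewrite scale1r /= addrC subrK.
rewrite (@lie_formula_lin _ A theta (contr_form B omega)
  (form_sub theta (contr_form B omega)) 1).
  2: by move=> y; rewrite scale1r /= addrC subrK.
rewrite (exterior_formula_cartan A omega) (lie_formula_vcons A B omega).
by rewrite !mul1r !ev_vcons; ring.
Qed.

Section Basic.
Context (S : forall x : M, set (tangent x)).

(** Pointwise, such forms belong to the exterior power of the annihilator of [S]. *)
Definition basic k (w : diff_form M k.+1) : Prop :=
  forall y (v : tangent y), S v -> contr v (w y) = 0.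

Context (S_inv : involutive_distribution S).

Lemma lie_formula_basic k A C (w : diff_form M k.+1) (V : 'I_k -> vfield M) x :
  basic w -> (forall y, S (A y)) -> (forall y, S (C y)) ->
  lie_formula A w (vcons C V) x = 0.
Proof.
move=> bw SA SC; rewrite lie_formula_vcons lie_formula0 => [|y]; last exact: bw.
have := bw x _ (S_inv SA SC x) => /(congr1 (fun a : altform _ _ => a (ev V x))) /= ->.
by rewrite subrr.
Qed.

(** In the expansion of [exterior_formula] after [B] and [C], every term contracts
    [w] with [B], with [C] or with [[B, C]]. *)
Lemma exterior_formula_basic k B C (w : diff_form M k.+1) (V : 'I_k -> vfield M) x :
  basic w -> (forall y, S (B y)) -> (forall y, S (C y)) ->
  exterior_formula w (vcons B (vcons C V)) x = 0.
Proof.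
move=> bw SB SC.
have wBC : w x (vcons (lie_bracket B C x) (ev V x)) = 0.
  by have := bw x _ (S_inv SB SC x) => /(congr1 (fun a : altform _ _ => a (ev V x))).
have cB y : contr_form B w y = 0 by exact: bw.
have cC y : contr_form C w y = 0 by exact: bw.
case: k w V bw wBC cB cC => [|k] w V bw wBC cB cC.
  by rewrite exterior_formula_vcons0 wBC !lie_formula0 // !subr0.
rewrite exterior_formula_vconsS wBC !lie_formula0 // !subr0 add0r.
apply: exterior_formula0 => y; apply/val_inj/funext => u.
by rewrite -[LHS]/(contr_form B w y (vcons (C y) u)) cB.
Qed.

End Basic.
End Dorfman.

(* The degree of the bundle is [p.+1]: it ranges over the integers [>= 1]. *)
Theorem theorem3p12 (R : realType) (n : nat) (M : manifold R n) (p : nat)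
    (L : forall x : M, set (Ebundle M p.+1 x)) (omega : diff_form M p.+2)
    (L_subbundle : smooth_subbundle L)
    (L_lagrangian : lagrangian L)
    (S_rank : constant_rank (pr_tangent L))
    (L_def : forall x, L x =
       [set e | exists (X : tangent x) (a : altform (tangent x) p.+1),
          [/\ pr_tangent L x X, wedge_ann (pr_tangent L x) a &
              e = (X, contr X (omega x) + a)]]) :
  involutive_subbundle L <->
  (involutive_distribution (pr_tangent L) /\
   forall (x : M) (X1 X2 X3 : tangent x) (Y : 'I_p -> tangent x),
     pr_tangent L x X1 -> pr_tangent L x X2 -> pr_tangent L x X3 ->
     ext_deriv omega x (vcons X1 (vcons X2 (vcons X3 Y))) = 0).
Proof.
have fields_through x (Y : 'I_p -> tangent x) :
    exists V : 'I_p -> vfield M, Y = fun i => V i x.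
  exists (fun i => sval (cid (vfield_through (Y i)))).
  by apply/funext => i; case: cid.
split=> [L_inv|[S_inv dw0]].
(* The sections [A + i_A omega] lie in [L] and lift every section [A] of [S]. *)
- have graph (A : vfield M) : (forall y, pr_tangent L y (A y)) ->
      forall y, L y (Esection_at (A, contr_form A omega) y).
    move=> SA y; rewrite L_def; exists (A y), 0; split; [exact: SA| exact: wedge_ann0 |].
    by rewrite addr0.
  have S_inv : involutive_distribution (pr_tangent L).
    move=> A B SA SB x; have := L_inv _ _ (graph A SA) (graph B SB) x.
    by move=> LD; exists (dorfman (A, contr_form A omega) (B, contr_form B omega) x).
  split=> // x X1 X2 X3 Y S1 S2 S3.
  have [A [<- SA]] := pr_tangent_section L_subbundle S1.
  have [B [<- SB]] := pr_tangent_section L_subbundle S2.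
  have [C [<- SC]] := pr_tangent_section L_subbundle S3.
  have [V ->] := fields_through x Y.
  have := L_inv _ _ (graph A SA) (graph B SB) x; rewrite L_def => -[X [a [SX Sa]]].
  move=> E; have EX : lie_bracket A B x = X := congr1 fst E.
  have Ea : lie_derivative A (contr_form B omega) x -
    contr (B x) (ext_deriv (contr_form A omega) x) = contr X (omega x) + a := congr1 snd E.
  have := dorfman_defect omega (contr_form A omega) (contr_form B omega) A B C V x.
  rewrite Ea EX [_ + a]addrC addrK.
  have /(congr1 (fun b : altform _ _ => b (fun i => V i x))) /= -> := wedge_ann_contr Sa (SC x).
  rewrite lie_formula0 => [|y]; last by rewrite /= subrr.
  rewrite exterior_formula0 => [|y]; last by rewrite /= subrr.
  by rewrite subr0 add0r -!ev_vcons ext_derivE.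
have S_of (e : Esection M p.+1) : (forall y, L y (Esection_at e y)) ->
    forall y, pr_tangent L y (e.1 y).
  by move=> Le y; exists (Esection_at e y).
have basic_of (e : Esection M p.+1) : (forall y, L y (Esection_at e y)) ->
    basic (pr_tangent L) (form_sub e.2 (contr_form e.1 omega)).
  move=> Le y v Sv; have := Le y; rewrite L_def => -[X [a [SX Sa E]]].
  have EX : e.1 y = X := congr1 fst E.
  have Ea : e.2 y = contr X (omega y) + a := congr1 snd E.
  have -> : form_sub e.2 (contr_form e.1 omega) y = a.
    by rewrite /= Ea EX addrC addKr.
  exact: wedge_ann_contr Sa Sv.
move=> e f Le Lf x.
(* [L = L^perp]: it remains to pair the bracket with the elements of [L]. *)
rewrite L_lagrangian => l /[dup] Ll; rewrite L_def => -[X3 [c [S3 Sc ->]]].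
have [C [EC SC]] := pr_tangent_section L_subbundle S3; subst X3.
have SD := S_inv _ _ (S_of e Le) (S_of f Lf) x.
apply/val_inj/funext => u; have [V ->] := fields_through x u.
have := dorfman_defect omega e.2 f.2 e.1 f.1 C V x.
rewrite (lie_formula_basic S_inv V x (basic_of f Lf) (S_of e Le) SC).
rewrite (exterior_formula_basic S_inv V x (basic_of e Le) (S_of f Lf) SC).
rewrite subr0 add0r -ext_derivE !ev_vcons dw0; [|exact: S_of|exact: S_of|exact: SC].
move=> D0.
have c0 := congr1 (fun b : altform _ _ => b (fun i => V i x)) (wedge_ann_contr Sc SD).
have sw := altform_vcons_swap (omega x) (C x) (lie_bracket e.1 f.1 x) (fun i => V i x).
set d := (lie_derivative _ _ _ - _) in D0.
rewrite -[LHS]/(omega x (vcons (C x) (vcons (lie_bracket e.1 f.1 x) (fun i => V i x)))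
  + c (vcons (lie_bracket e.1 f.1 x) (fun i => V i x)) + d (vcons (C x) (fun i => V i x))).
have {}D0 : d (vcons (C x) (fun i => V i x)) =
    omega x (vcons (lie_bracket e.1 f.1 x) (vcons (C x) (fun i => V i x))).
  by apply/eqP; rewrite -subr_eq0; apply/eqP.
have {}c0 : c (vcons (lie_bracket e.1 f.1 x) (fun i => V i x)) = 0 := c0.
by rewrite D0 c0 sw addr0 addNr.
Qed.
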